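(* Let $A\in\mathbb{R}^{n\times n}$ with $\rho(A)<1$, $C\in\mathbb{R}^{m\times n}$, $Q\in\mathbb{R}^{n\times n}$ with $Q\ge 0$, and $R\in\mathbb{R}^{m\times m}$ with $R>0$. Let $\mathcal{P}(K)$, $\mathcal{S}(K)$ and $K_{\mathrm{kf}}$ be as defined in the context, and let $\delta\in[\mathcal{P}(K_{\mathrm{kf}}),\mathcal{P}(0)]$. For $\lambda\ge 0$ let $X\ge 0$ be the unique positive semidefinite solution of the Riccati equation $$X = AXA^{\mathsf T} - AXC^{\mathsf T}\left(CXC^{\mathsf T}+I_m+\lambda R\right)^{-1}CXA^{\mathsf T}+\lambda Q,$$ and let $$K^*(\lambda)=XC^{\mathsf T}\left(CXC^{\mathsf T}+I_m+\lambda R\right)^{-1}.$$ Then the global minimum of the problem $$\min_{K}\ \mathcal{S}(K)\quad\text{subject to}\quad \mathcal{P}(K)\le\delta ,$$ where $K$ ranges over all $K\in\mathbb{R}^{n\times m}$ with $\rho(A-KCA)<1$, is attained at $K=K^*(\lambda)$, where $\lambda$ is selected such that $\mathcal{P}(K^*(\lambda))=\delta$ (at the endpoint $\delta=\mathcal{P}(K_{\mathrm{kf}})$ the value $\lambda=\infty$ is allowed, with $K^*(\infty):=\lim_{\lambda\to\infty}K^*(\lambda)=K_{\mathrm{kf}}$).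
   Context: All matrices are real; $\rho(\cdot)$ is the spectral radius; $M\ge0$ ($M>0$) means symmetric positive semidefinite (definite). Consider the system $x(t+1)=Ax(t)+w(t)$, $y(t)=Cx(t)+v(t)$, with $w(t)\sim\mathcal N(0,Q)$, $v(t)\sim\mathcal N(0,R)$, $x(0)\sim\mathcal N(0,\Sigma_0)$ independent of each other at all times, and the linear filter $\hat x(t+1)=A\hat x(t)+K[y(t+1)-CA\hat x(t)]$ with constant gain $K\in\mathbb{R}^{n\times m}$. Write $A_K=A-KCA$ and $B_K=I_n-KC$. Only gains $K$ with $\rho(A_K)<1$ are considered. For such $K$, the steady-state error covariance $P(K)\ge0$ is the unique solution of $P(K)=A_KP(K)A_K^{\mathsf T}+B_KQB_K^{\mathsf T}+KRK^{\mathsf T}$, and the error is $\mathcal P(K)=\mathrm{Tr}(P(K))$. The sensitivity is $\mathcal S(K)=\mathrm{Tr}\left[\frac{d}{dR}\mathcal P(K)\right]$, where $\frac{d}{dR}\mathcal P(K)$ is the $m\times m$ matrix gradient of $\mathcal P(K)$ with respect to $R$ (with $A,C,Q,K$ fixed), i.e. the matrix $G$ with $d\mathcal P(K)=\mathrm{Tr}(G^{\mathsf T}dR)$. Equivalently, $\mathcal S(K)=\mathrm{Tr}(S(K))$, where $S(K)\ge0$ solves $S(K)=A_KS(K)A_K^{\mathsf T}+KK^{\mathsf T}$. $K_{\mathrm{kf}}$ is the steady-state Kalman filter gain, which minimizes $\mathcal P(K)$: $K_{\mathrm{kf}}=\Sigma C^{\mathsf T}(C\Sigma C^{\mathsf T}+R)^{-1}$,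 where $\Sigma\ge0$ is the unique positive semidefinite solution of $\Sigma=A\Sigma A^{\mathsf T}-A\Sigma C^{\mathsf T}(C\Sigma C^{\mathsf T}+R)^{-1}C\Sigma A^{\mathsf T}+Q$. *)

(* Defs.v *)
From HB Require Import structures.
From mathcomp Require Import all_boot all_order all_algebra.
From mathcomp Require Import all_classical all_reals all_analysis.
From mathcomp Require Import complex.

Set Implicit Arguments.
Unset Strict Implicit.
Unset Printing Implicit Defensive.

Import Order.TTheory GRing.Theory Num.Theory.
Import numFieldNormedType.Exports.

Local Open Scope classical_set_scope.
Local Open Scope ring_scope.

(* The largest modulus of a complex eigenvalue.  The set is finite; it is empty
   only for n = 0, where sup gives 0. *)
Definition spectral_radius (F : realType) (n : nat) (M : 'M[F]_n) : F :=
  sup [set r | exists2 mu : F[i],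
         eigenvalue (map_mx (real_complex F) M) mu & r = ComplexField.Normc.normc mu].

Definition psdmx (F : realType) (n : nat) (M : 'M[F]_n) : Prop :=
  M^T = M /\ forall x : 'cV[F]_n, 0 <= (x^T *m M *m x) 0 0.

Definition pdmx (F : realType) (n : nat) (M : 'M[F]_n) : Prop :=
  M^T = M /\ forall x : 'cV[F]_n, x != 0 -> 0 < (x^T *m M *m x) 0 0.

Section Filter.
Variables (F : realType) (n m : nat).
Implicit Types (A Q X : 'M[F]_n) (C : 'M[F]_(m, n)) (R : 'M[F]_m).
Implicit Types (K : 'M[F]_(n, m)).

Definition err_mx A C K : 'M[F]_n := A - K *m C *m A.

Definition innov_mx C K : 'M[F]_n := 1%:M - K *m C.

(* The solution is unique, without any sign or symmetry condition, when
   err_mx A C K is Schur stable; it is then positive semidefinite for Q, R >= 0.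
   Not restricting to P >= 0 makes it a function of every R in 'M_m, as needed
   to differentiate it in all matrix directions. *)
Definition err_cov A C Q R K : 'M[F]_n :=
  get [set P : 'M[F]_n | P = err_mx A C K *m P *m (err_mx A C K)^T
                           + innov_mx C K *m Q *m (innov_mx C K)^T
                           + K *m R *m K^T].

Definition filter_err A C Q R K : F := \tr (err_cov A C Q R K).

(* The matrix G with df = Tr(G^T dR) at R. *)
Definition mx_gradient (f : 'M[F]_m -> F) R : 'M[F]_m :=
  get [set G : 'M[F]_m | differentiable f R /\
         forall H : 'M[F]_m, 'd f R H = \tr (G^T *m H)].

Definition sensitivity A C Q R K : F :=
  \tr (mx_gradient (fun R' => filter_err A C Q R' K) R).

Definition riccati_sol A C Q R X : Prop :=
  psdmx X /\
  X = A *m X *m A^T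
      - A *m X *m C^T *m invmx (C *m X *m C^T + R) *m C *m X *m A^T
      + Q.

Definition riccati A C Q R : 'M[F]_n := get [set X | riccati_sol A C Q R X].

Definition kalman_gain A C Q R : 'M[F]_(n, m) :=
  let X := riccati A C Q R in
  X *m C^T *m invmx (C *m X *m C^T + R).

(* K*(lambda) for lambda in [0, +oo]; the value at -oo is irrelevant. *)
Definition Kstar A C Q R (l : \bar F) : 'M[F]_(n, m) :=
  let Kfin (r : F) := kalman_gain A C (r *: Q) (1%:M + r *: R) in
  match l with
  | EFin r => Kfin r
  | +oo%E => lim (Kfin r @[r --> +oo])
  | -oo%E => 0
  end.

Definition feasible A C Q R (delta : F) : set 'M[F]_(n, m) :=
  [set K | spectral_radius (err_mx A C K) < 1 /\ filter_err A C Q R K <= delta].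

End Filter.

Definition global_min_at (F : realType) (T : Type) (f : T -> F) (D : set T)
    (x : T) : Prop :=
  D x /\ forall y, D y -> f x <= f y.

(* Main.v *)
(* The sensitivity is the error of the same filter for Q = 0 and R = I, and the
   error is affine in (Q, R); hence S + lambda P is the error for (lambda Q,
   I + lambda R), whose unique minimizer over stabilizing gains is the Kalman
   gain K_lambda, by completing the square.  If P K_lambda = delta >= P K, then
   S K_lambda <= S K follows.  For t = lambda / (1 + lambda), this is also the gain
   for (t Q, (1 - t) I + t R), a path from 0 to K_kf defined on all of [0, 1];
   comparing minimizers shows that it is Hoelder continuous of exponent 1/2, so
   the intermediate value theorem selects lambda. *)
Require Import Defs.
From HB Require Import structures.
From mathcomp Require Import all_boot all_order all_algebra.
From mathcomp Require Import all_classical all_reals all_analysis.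
From mathcomp Require Import complex ring lra.

Set Implicit Arguments.
Unset Strict Implicit.
Unset Printing Implicit Defensive.

Import Order.TTheory GRing.Theory Num.Theory.
Import numFieldNormedType.Exports.

Local Open Scope classical_set_scope.
Local Open Scope ring_scope.

(** * Entrywise sum norm *)

Section EntrywiseNorm.
Variable R : numDomainType.

(** With [Q] only semidefinite, stability of a Kalman gain comes from the stability of [A] and the
    definite measurement noise: an unstable mode would have to bypass the gain and so belong to [A].
    Continuity of Riccati solutions in their data is never studied; gains are compared through their
    costs. The tool is a quadratic gap: any stabilizing K costs at least r |K - K_opt|^2 more than
    the minimizer, r being a lower bound of the noise, common to the whole path. The gap gives
    uniqueness, hence invariance under scaling and the case lambda = infinity, where only K_kf is
    feasible. The Hoelder estimate also needs bounds along the path: comparison with K = 0, where S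
    vanishes, bounds P by P(0), and R >= r I bounds S by P / r. Passing from the gain to P meets an
    obstacle: decay rates of the error dynamics are not known to be uniform. The difference of two
    errors is therefore a Lyapunov solution for the dynamics at one fixed t, with one adjoint Z,
    while the other covariance is controlled by its trace. *)

Definition l1norm m n (M : 'M[R]_(m, n)) : R := \sum_i \sum_j `|M i j|.

Lemma l1norm_ge0 m n (M : 'M[R]_(m, n)) : 0 <= l1norm M.
Proof. by apply: sumr_ge0 => i _; apply: sumr_ge0. Qed.

Lemma l1normD m n (M N : 'M[R]_(m, n)) : l1norm (M + N) <= l1norm M + l1norm N.
Proof.
rewrite /l1norm -big_split ler_sum // => i _.
by rewrite -big_split ler_sum // => j _; rewrite mxE ler_normD.
Qed.

Lemma l1normZ m n a (M : 'M[R]_(m, n)) : l1norm (a *: M) = `|a| * l1norm M.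
Proof.
rewrite /l1norm mulr_sumr; apply: eq_bigr => i _; rewrite mulr_sumr.
by apply: eq_bigr => j _; rewrite mxE normrM.
Qed.

Lemma l1normN m n (M : 'M[R]_(m, n)) : l1norm (- M) = l1norm M.
Proof. by rewrite -scaleN1r l1normZ normrN1 mul1r. Qed.

Lemma l1norm0 m n : l1norm (0 : 'M[R]_(m, n)) = 0.
Proof. by rewrite -(scale0r 0) l1normZ normr0 mul0r. Qed.

Lemma l1norm_tr m n (M : 'M[R]_(m, n)) : l1norm M^T = l1norm M.
Proof.
rewrite /l1norm exchange_big; apply: eq_bigr => i _.
by apply: eq_bigr => j _; rewrite mxE.
Qed.

Lemma entry_le_l1norm m n (M : 'M[R]_(m, n)) i j : `|M i j| <= l1norm M.
Proof.
rewrite /l1norm (bigD1 i) //= (bigD1 j) //= -addrA lerDl.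
by rewrite addr_ge0 // sumr_ge0 // => k _; apply: sumr_ge0.
Qed.

Lemma l1normM m n p (M : 'M[R]_(m, n)) (N : 'M[R]_(n, p)) :
  l1norm (M *m N) <= l1norm M * l1norm N.
Proof.
rewrite {1 2}/l1norm mulr_suml ler_sum // => i _; rewrite mulr_suml.
apply: (@le_trans _ _ (\sum_j \sum_k `|M i k| * `|N k j|)).
  rewrite ler_sum // => j _; rewrite mxE; apply: le_trans (ler_norm_sum _ _ _) _.
  by rewrite ler_sum // => k _; rewrite normrM.
rewrite exchange_big ler_sum // => k _; rewrite -mulr_sumr ler_wpM2l //.
by rewrite /l1norm (bigD1 k) //= lerDl; apply: sumr_ge0 => l _; apply: sumr_ge0.
Qed.

Lemma normr_trace_le n (M : 'M[R]_n) : `|\tr M| <= l1norm M.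
Proof.
apply: le_trans (ler_norm_sum _ _ _) _; rewrite ler_sum // => i _.
by rewrite (bigD1 i) //= lerDl sumr_ge0.
Qed.

End EntrywiseNorm.

(** * Spectral radius and geometric decay of powers *)

Section PowerDecay.

(* N * M ^+ k.+1 = mu *: (N * M ^+ k) + N * (M - mu%:M) * M ^+ k, so a factor
   M - mu%:M is removed at a time. *)
Lemma geometric_decay (R : numFieldType) n (M N : 'M[R]_n) (s : seq R) (g : R) :
    0 < g -> {in s, forall mu, `|mu| < g} ->
    N * \prod_(mu <- s) (M - mu%:M) = 0 ->
  exists2 c, 0 <= c & forall k, l1norm (N * M ^+ k) <= c * g ^+ k.
Proof.
move=> g0; elim: s N => [|mu s IHs] N sg.
  rewrite big_nil mulr1 => ->; exists 0 => // k.
  by rewrite mul0r l1norm0 mul0r.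
rewrite big_cons mulrA => /IHs[i si|c0 c00 Hc0].
  by apply: sg; rewrite inE si orbT.
have mug : 0 < g - `|mu| by rewrite subr_gt0 sg ?mem_head.
(* The second summand makes [c0] at most [c] times the gap [g - |mu|], which is the induction step;
   the first covers exponent 0. *)
exists (l1norm N + c0 / (g - `|mu|)).
  by rewrite addr_ge0 ?l1norm_ge0 // divr_ge0 // ltW.
elim=> [|k IHk].
  by rewrite !expr0 !mulr1 lerDl divr_ge0 // ltW.
have -> : N * M ^+ k.+1 = mu *: (N * M ^+ k) + N * (M - mu%:M) * M ^+ k.
  rewrite mulrBr mulrBl -mulrA -exprS addrC.
  have -> : N * mu%:M * M ^+ k = mu *: (N * M ^+ k).
    have -> : N * mu%:M = mu *: N by exact: mul_mx_scalar.
    exact/esym/(@scalemxAl R n n n).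
  by rewrite subrK.
apply: le_trans (l1normD _ _) _; rewrite l1normZ.
set c := (X in X * g ^+ k) in IHk *.
apply: (@le_trans _ _ (`|mu| * (c * g ^+ k) + c0 * g ^+ k)).
  by rewrite lerD // ler_wpM2l.
rewrite exprS [leRHS]mulrCA !mulrA -mulrDl ler_wpM2r ?exprn_ge0 ?(ltW g0) //.
rewrite -lerBrDl -mulrBl /c mulrDr [X in _ + X]mulrC divfK ?gt_eqF // lerDr.
by rewrite mulr_ge0 ?l1norm_ge0 // ltW.
Qed.

Lemma lt1_gap (F : realFieldType) (s : seq F) : {in s, forall x, x < 1} ->
  exists2 g, 0 < g < 1 & {in s, forall x, x < g}.
Proof.
elim: s => [_|x s IHs xs]; first by exists 2^-1 => //; lra.
have [|g g01 sg] := IHs; first by move=> y ys; apply: xs; rewrite inE ys orbT.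
have x1 : x < 1 by apply: xs; rewrite mem_head.
exists (Num.max g ((1 + x) / 2)).
  by rewrite lt_max gt_max; case/andP: g01 => -> -> /=; lra.
move=> y; rewrite inE => /predU1P[->|ys].
  by rewrite lt_max; apply/orP; right; lra.
by rewrite lt_max sg.
Qed.

Variable F : realType.
Local Notation normc := ComplexField.Normc.normc.

Definition schur_stable n (M : 'M[F]_n) :=
  forall mu, eigenvalue (map_mx (real_complex F) M) mu -> normc mu < 1.

Lemma char_poly_roots n (M : 'M[F]_n) : exists s : seq F[i],
  forall mu, (mu \in s) = eigenvalue (map_mx (real_complex F) M) mu.
Proof.
set N := map_mx _ M.
have [s Hs] := closed_field_poly_normal (char_poly N).
exists s => mu; rewrite eigenvalue_root_char Hs.
by rewrite (monicP (char_poly_monic _)) scale1r root_prod_XsubC.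
Qed.

Lemma spectral_radius_lt1 n (M : 'M[F]_n) :
  spectral_radius M < 1 <-> schur_stable M.
Proof.
have [s Hs] := char_poly_roots M; split=> [M1 mu muM|M1].
  apply: le_lt_trans M1; apply: ub_le_sup; last by exists mu.
  (* A supremum dominates its set only if the set is bounded; the sum of all moduli is a bound. *)
  exists (\sum_(x <- s) normc x) => _ [x xM ->].
  rewrite -Hs in xM.
  have nn (y : F[i]) : 0 <= normc y by case: y => a b; exact: sqrtr_ge0.
  by rewrite (big_rem x) //= lerDl sumr_ge0.
(* Strict bounds on the elements would only give a supremum at most 1; finiteness provides a common
   [g < 1]. *)
have [|g /andP[g0 g1] Hg] := @lt1_gap F [seq normc x | x <- s].
  by move=> _ /mapP[x xs ->]; apply: M1; rewrite -Hs.
rewrite /spectral_radius; set E := [set _ | _].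
have [->|/set0P E0] := eqVneq E set0; first by rewrite sup0.
apply: le_lt_trans g1; apply: ge_sup => // _ [x xM ->]; apply/ltW/Hg.
by apply: map_f; rewrite Hs.
Qed.

Lemma l1norm_map_complex m n (M : 'M[F]_(m, n)) :
  l1norm (map_mx (real_complex F) M) = real_complex F (l1norm M).
Proof.
rewrite /l1norm rmorph_sum; apply: eq_bigr => i _.
rewrite rmorph_sum; apply: eq_bigr => j _; rewrite mxE.
by rewrite normc_def /= expr0n addr0 sqrtr_sqr.
Qed.

Definition power_decay n (M : 'M[F]_n) := exists c g : F,
  [/\ 0 <= c, 0 < g < 1 & forall k, l1norm (M ^+ k) <= c * g ^+ k].

Lemma power_decay_tr n (M : 'M[F]_n) : power_decay M -> power_decay M^T.
Proof.
move=> [c [g [c0 g01 H]]]; exists c, g; split=> // k.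
suff -> : M^T ^+ k = (M ^+ k)^T by rewrite l1norm_tr.
elim: k => [|k IHk]; first by rewrite !expr0 trmx1.
by rewrite exprS exprSr IHk trmx_mul.
Qed.

(** Over the complex numbers the characteristic polynomial splits, and Cayley-Hamilton is the
    vanishing product required by [geometric_decay] with [N = 1]. *)
Lemma schur_stable_power_decay n (M : 'M[F]_n) :
  schur_stable M -> power_decay M.
Proof.
move=> M1; set N := map_mx (real_complex F) M.
have [s Hs] := closed_field_poly_normal (char_poly N).
rewrite (monicP (char_poly_monic _)) scale1r in Hs.
have sE x : (x \in s) = eigenvalue N x.
  by rewrite eigenvalue_root_char Hs root_prod_XsubC.
have [|g g01 Hg] := @lt1_gap F [seq normc x | x <- s].
  by move=> _ /mapP[x xs ->]; apply: M1; rewrite -sE.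
have [|||c c0 Hc] := @geometric_decay _ n N 1 s (real_complex F g).
- by case/andP: g01 => g0 _; rewrite ltcR.
- move=> x xs; have := Hg _ (map_f _ xs).
  by rewrite -ltcR.
- rewrite mul1r; case: n M N {M1 Hg} Hs sE => [|n] M N Hs sE.
    by apply/matrixP => -[].
  have := Cayley_Hamilton N; rewrite Hs rmorph_prod => <-; apply: eq_bigr => x _.
  by rewrite rmorphB /= horner_mx_X horner_mx_C.
(* [0 <= c] in [F[i]] forces [c] to be real, so its real part carries the same bound. *)
exists (complex.Re c), g; split=> // [|k]; first by rewrite -ler0c RRe_real ?ger0_real.
rewrite -lecR; have := Hc k; rewrite mul1r.
have -> : N ^+ k = map_mx (real_complex F) (M ^+ k).
  elim: k => [|k IHk]; first by rewrite !expr0 map_mx1.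
  by rewrite !exprS IHk map_mxM.
by rewrite l1norm_map_complex rmorphM rmorphXn /= RRe_real ?ger0_real.
Qed.

End PowerDecay.

(** * Semidefinite matrices and quadratic forms *)

Section Semidefinite.
Variable F : realType.

Definition qform n (M : 'M[F]_n) (x : 'cV[F]_n) : F := (x^T *m M *m x) 0 0.

Lemma qformD n (M N : 'M[F]_n) x : qform (M + N) x = qform M x + qform N x.
Proof. by rewrite /qform mulmxDr mulmxDl mxE. Qed.

Lemma qformZ n a (M : 'M[F]_n) x : qform (a *: M) x = a * qform M x.
Proof. by rewrite /qform -scalemxAr -scalemxAl mxE. Qed.

Lemma qformN n (M : 'M[F]_n) x : qform (- M) x = - qform M x.
Proof. by rewrite -scaleN1r qformZ mulN1r. Qed.

Lemma qformB n (M N : 'M[F]_n) x : qform (M - N) x = qform M x - qform N x.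
Proof. by rewrite qformD qformN. Qed.

Lemma qform_conj n p (L : 'M[F]_(p, n)) (M : 'M[F]_n) x :
  qform (L *m M *m L^T) x = qform M (L^T *m x).
Proof. by rewrite /qform trmx_mul trmxK !mulmxA. Qed.

Lemma qformE n (M : 'M[F]_n) x :
  qform M x = \sum_j \sum_i x i 0 * M i j * x j 0.
Proof.
rewrite /qform mxE; apply: eq_bigr => j _; rewrite mxE mulr_suml.
by apply: eq_bigr => i _; rewrite mxE.
Qed.

Lemma qform_delta n (M : 'M[F]_n) (i j : 'I_n) (a b : F) :
  qform M (a *: delta_mx i 0 + b *: delta_mx j 0) =
  a ^+ 2 * M i i + a * b * (M i j + M j i) + b ^+ 2 * M j j.
Proof.
have entry k l : ((delta_mx k 0 : 'cV[F]_n)^T *m M *m (delta_mx l 0 : 'cV[F]_n)) 0 0 = M k l.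
  by rewrite trmx_delta -rowE -colE !mxE.
have H k l (c d : F) :
   (c *: (delta_mx k 0 : 'cV[F]_n)^T *m M *m (d *: (delta_mx l 0 : 'cV[F]_n))) 0 0 = c * d * M k l.
  by rewrite -scalemxAr -!scalemxAl mxE [X in _ * X]mxE entry mulrCA mulrA.
rewrite /qform; set ei := delta_mx i 0; set ej := delta_mx j 0.
have -> : (a *: ei + b *: ej)^T = a *: ei^T + b *: ej^T by rewrite linearD !linearZ.
rewrite !mulmxDl !mulmxDr.
have entryD (u v : 'M[F]_1) : (u + v) 0 0 = u 0 0 + v 0 0 by rewrite mxE.
by rewrite !entryD !H; ring.
Qed.

Lemma psdmx_qform n (M : 'M[F]_n) : psdmx M -> forall x, 0 <= qform M x.
Proof. by case. Qed.

Lemma psdmx0 n : psdmx (0 : 'M[F]_n).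
Proof. by split=> [|x]; rewrite ?trmx0 // mulmx0 mul0mx mxE. Qed.

Lemma psdmxD n (M N : 'M[F]_n) : psdmx M -> psdmx N -> psdmx (M + N).
Proof.
move=> [Ms M0] [Ns N0]; split=> [|x]; first by rewrite linearD /= Ms Ns.
by rewrite -/(qform _ _) qformD addr_ge0 ?M0 ?N0.
Qed.

Lemma psdmxZ n a (M : 'M[F]_n) : 0 <= a -> psdmx M -> psdmx (a *: M).
Proof.
move=> a0 [Ms M0]; split=> [|x]; first by rewrite linearZ /= Ms.
by rewrite -/(qform _ _) qformZ mulr_ge0 ?M0.
Qed.

Lemma psdmx_conj n p (L : 'M[F]_(p, n)) (M : 'M[F]_n) :
  psdmx M -> psdmx (L *m M *m L^T).
Proof.
move=> [Ms M0]; split=> [|x]; first by rewrite !trmx_mul trmxK Ms mulmxA.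
by rewrite -/(qform _ _) qform_conj M0.
Qed.

Lemma qform1 n (x : 'cV[F]_n) : qform 1%:M x = \sum_i x i 0 ^+ 2.
Proof.
by rewrite /qform mulmx1 mxE; apply: eq_bigr => i _; rewrite mxE expr2.
Qed.

Lemma psdmx1 n : psdmx (1%:M : 'M[F]_n).
Proof.
split=> [|x]; first by rewrite trmx1.
by rewrite -/(qform _ _) qform1 sumr_ge0 // => i _; exact: sqr_ge0.
Qed.

Lemma pdmx_psd n (M : 'M[F]_n) : pdmx M -> psdmx M.
Proof.
move=> [Ms M0]; split=> // x; have [->|/M0/ltW//] := eqVneq x 0.
by rewrite mulmx0 mxE.
Qed.

Lemma psdmx_diag_ge0 n (M : 'M[F]_n) i : psdmx M -> 0 <= M i i.
Proof.
move/psdmx_qform/(_ (1 *: delta_mx i 0 + 0 *: delta_mx i 0)).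
by rewrite qform_delta; lra.
Qed.

Lemma psdmx_trace_ge0 n (M : 'M[F]_n) : psdmx M -> 0 <= \tr M.
Proof. by move=> M0; apply: sumr_ge0 => i _; exact: psdmx_diag_ge0. Qed.

(** Positivity at e_i + e_j and e_i - e_j bounds the entry by the mean of two diagonal entries. *)
Lemma psdmx_entry_le n (M : 'M[F]_n) i j : psdmx M -> `|M i j| <= \tr M.
Proof.
move=> M0; have tr_diag k : M k k <= \tr M.
  rewrite /mxtrace (bigD1 k) //= lerDl sumr_ge0 // => l _.
  exact: psdmx_diag_ge0.
have Ms : M j i = M i j by rewrite -{1}M0.1 mxE.
have q1 := psdmx_qform M0 (1 *: delta_mx i 0 + 1 *: delta_mx j 0).
have q2 := psdmx_qform M0 (1 *: delta_mx i 0 + (-1) *: delta_mx j 0).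
rewrite !qform_delta Ms in q1 q2.
have ti := tr_diag i; have tj := tr_diag j.
by rewrite ler_norml; lra.
Qed.

Lemma psdmx_l1norm n (M : 'M[F]_n) :
  psdmx M -> l1norm M <= \tr M *+ n *+ n.
Proof.
move=> M0; have -> : \tr M *+ n *+ n = \sum_(i < n) \sum_(j < n) \tr M.
  by rewrite !sumr_const !card_ord.
by rewrite ler_sum // => i _; rewrite ler_sum // => j _; exact: psdmx_entry_le.
Qed.

Lemma psdmx_trace0 n (M : 'M[F]_n) : psdmx M -> \tr M <= 0 -> M = 0.
Proof.
move=> M0 t0; apply/matrixP => i j; rewrite mxE; apply/eqP.
by rewrite -normr_le0 (le_trans (psdmx_entry_le _ _ M0)).
Qed.

Lemma psdmx_le_trace n (M N : 'M[F]_n) : psdmx (N - M) -> \tr M <= \tr N.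
Proof. by move=> /psdmx_trace_ge0; rewrite raddfB subr_ge0. Qed.

Lemma pdmxD_psd n (M N : 'M[F]_n) : psdmx M -> pdmx N -> pdmx (M + N).
Proof.
move=> [Ms M0] [Ns N0]; split=> [|x x0]; first by rewrite linearD /= Ms Ns.
by rewrite -/(qform _ _) qformD ltr_wpDl ?M0 ?N0.
Qed.

Lemma pdmx_unit n (M : 'M[F]_n) : pdmx M -> M \in unitmx.
Proof.
move=> [Ms M0]; rewrite -row_free_unit -kermx_eq0; apply/negPn/negP => /rowV0Pn.
move=> [v /sub_kermxP vM v0]; have /M0 : v^T != 0 by rewrite -trmx0 (inj_eq trmx_inj).
by rewrite trmxK vM mul0mx mxE ltxx.
Qed.

Lemma pdmxZ n a (M : 'M[F]_n) : 0 < a -> pdmx M -> pdmx (a *: M).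
Proof.
move=> a0 [Ms M0]; split=> [|x /M0 x0]; first by rewrite linearZ /= Ms.
by rewrite -/(qform _ _) qformZ mulr_gt0.
Qed.

Lemma pdmx1 n : pdmx (1%:M : 'M[F]_n).
Proof.
split=> [|x x0]; first by rewrite trmx1.
rewrite -/(qform _ _) qform1 lt0r sumr_ge0 ?andbT; last by move=> i _; exact: sqr_ge0.
apply: contraNneq x0 => /psumr_eq0P H; apply/eqP/colP => i; rewrite mxE.
by apply/eqP; rewrite -sqrf_eq0 H // => k _; exact: sqr_ge0.
Qed.

Lemma qform_le_l1norm n (M : 'M[F]_n) x :
  qform M x <= l1norm M * qform 1%:M x.
Proof.
have xle i j : `|x i 0 * x j 0| <= qform 1%:M x.
  have H k : x k 0 ^+ 2 <= qform 1%:M x.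
    rewrite qform1 (bigD1 k) //= lerDl sumr_ge0 // => l _; exact: sqr_ge0.
  have := H i; have := H j; have := sqr_ge0 (x i 0 - x j 0).
  have := sqr_ge0 (x i 0 + x j 0); rewrite ler_norml => h1 h2 h3 h4.
  by apply/andP; split; nra.
rewrite qformE exchange_big /l1norm mulr_suml ler_sum // => i _.
rewrite mulr_suml ler_sum // => j _; rewrite mulrAC.
apply: le_trans (ler_norm _) _; rewrite normrM mulrC.
by rewrite ler_wpM2l.
Qed.

(* Cauchy-Schwarz for the form M, applied to x and M^-1 x, bounds |x|^4 by
   (x, M x) (x, M^-1 x). *)
Lemma pdmx_lower_bound n (M : 'M[F]_n) : pdmx M ->
  exists2 r, 0 < r <= 1 & psdmx (M - r *: 1%:M).
Proof.
move=> Mpd; have Mu := pdmx_unit Mpd; have M0 := pdmx_psd Mpd.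
(* The summand 1 makes the margin [c^-1] positive and at most 1; [path_noise_bound] uses both. *)
set c := 1 + l1norm (invmx M).
have c1 : 1 <= c by rewrite lerDl l1norm_ge0.
have c0 : 0 < c by rewrite (lt_le_trans _ c1).
exists c^-1; first by rewrite invr_gt0 c0 invf_le1.
split=> [|x]; first by rewrite linearB linearZ /= trmx1 Mpd.1.
rewrite -/(qform _ _) qformB qformZ.
set q1 := qform 1%:M x; set qM := qform M x.
set qI := qform (invmx M) x.
have q10 : 0 <= q1 by exact/psdmx_qform/psdmx1.
have Iq : qI <= c * q1.
  by apply: le_trans (qform_le_l1norm _ _) _; rewrite ler_wpM2r // lerDr.
have key a : 0 <= qM - 2 * a * q1 + a ^+ 2 * qI.
  have -> : qM - 2 * a * q1 + a ^+ 2 * qI = qform M (x - a *: (invmx M *m x)).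
    set y := invmx M *m x.
    have My : M *m y = x by rewrite mulKVmx.
    have yM : y^T *m M = x^T by rewrite -{1}Mpd.1 -trmx_mul My.
    have yx : y^T *m x = x^T *m y by rewrite -{1}My mulmxA yM.
    rewrite /qM /q1 /qI /qform.
    have -> : (x - a *: y)^T = x^T - a *: y^T by rewrite linearB linearZ.
    have entryB (u v : 'M[F]_1) : (u - v) 0 0 = u 0 0 - v 0 0 by rewrite !mxE.
    have entryZ b (u : 'M[F]_1) : (b *: u) 0 0 = b * u 0 0 by rewrite mxE.
    rewrite !mulmxBl !mulmxBr -!scalemxAr -!scalemxAl yM.
    rewrite -![x^T *m M *m y]mulmxA My -![x^T *m invmx M *m x]mulmxA -/y mulmx1.
    by rewrite !(entryB, entryZ); ring.
  exact: psdmx_qform M0 _.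
(* Since [qI <= c * q1], the choice [a = c^-1] turns the inequality into [c^-1 * q1 <= qM]. *)
have := key c^-1; rewrite subr_ge0 => kk.
have cV : 0 < c^-1 by rewrite invr_gt0.
have ccV : c * c^-1 = 1 by rewrite divff ?gt_eqF.
have : c^-1 ^+ 2 * qI <= c^-1 * q1.
  by rewrite expr2 -mulrA ler_pM2l // ler_pdivrMl.
lra.
Qed.

End Semidefinite.

(** * Discrete Lyapunov equation *)

Section Lyapunov.
Variables (F : realType) (n : nat).
Implicit Types M W X Z : 'M[F]_n.

Lemma le0_geometric (a c g : F) :
  0 < g < 1 -> (forall k, a <= c * g ^+ k) -> a <= 0.
Proof.
move=> /andP[g0 g1] H; rewrite leNgt; apply/negP => a0.
have /cvgr0_norm_lt/(_ a a0)[N _ /(_ N (leqnn N))] : geometric c g @ \oo --> 0.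
  by apply: cvg_geometric; rewrite gtr0_norm.
by rewrite /= => /(le_lt_trans (ler_norm _)); rewrite ltNge H.
Qed.

(** [V] is the sum of the first k conjugates of [W]; only its sign matters later. *)
Lemma lyapunov_iter M W X k : X = M *m X *m M^T + W ->
  exists2 V, X = M ^+ k *m X *m (M ^+ k)^T + V & psdmx W -> psdmx V.
Proof.
move=> HX; elim: k => [|k [V Vk Vpsd]].
  exists 0; last by move=> _; exact: psdmx0.
  by rewrite expr0 mul1mx trmx1 mulmx1 addr0.
exists (M ^+ k *m W *m (M ^+ k)^T + V).
  rewrite exprSr -[M ^+ k * M]/(M ^+ k *m M) trmx_mul {1}Vk {1}HX.
  by rewrite mulmxDr mulmxDl !mulmxA addrA.
by move=> W0; apply: psdmxD (Vpsd W0); exact: psdmx_conj.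
Qed.

Lemma l1norm_power_conj M X c g k : 0 <= c -> 0 < g < 1 ->
  (forall k, l1norm (M ^+ k) <= c * g ^+ k) ->
  l1norm (M ^+ k *m X *m (M ^+ k)^T) <= c * l1norm X * c * g ^+ k.
Proof.
move=> c0 /andP[g0 g1] H; apply: le_trans (l1normM _ _) _; rewrite l1norm_tr.
apply: (@le_trans _ _ (c * g ^+ k * l1norm X * (c * 1))).
  apply: ler_pM; rewrite ?l1norm_ge0 //.
    by apply: le_trans (l1normM _ _) _; rewrite ler_wpM2r ?l1norm_ge0.
  by apply: le_trans (H k) _; rewrite ler_wpM2l // exprn_ile1 ?ltW.
by rewrite mulr1 [X in X * c <= _]mulrAC -!mulrA [g ^+ k * c]mulrC.
Qed.

Lemma lyapunov_homogeneous M X :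
  power_decay M -> X = M *m X *m M^T -> X = 0.
Proof.
move=> [c [g [c0 g01 H]]] HX; apply/matrixP => i j; rewrite mxE.
have pwX k : X = M ^+ k *m X *m (M ^+ k)^T.
  elim: k => [|k IHk]; first by rewrite expr0 mul1mx trmx1 mulmx1.
  rewrite exprSr -[M ^+ k * M]/(M ^+ k *m M) trmx_mul {1}IHk {1}HX.
  by rewrite !mulmxA.
apply/eqP; rewrite -normr_le0; apply: (le0_geometric (c := c * l1norm X * c) g01) => k.
apply: le_trans (entry_le_l1norm _ _ _) _; rewrite {1}(pwX k).
exact: l1norm_power_conj.
Qed.

Lemma lyapunov_unique M W X Y : power_decay M ->
  X = M *m X *m M^T + W -> Y = M *m Y *m M^T + W -> X = Y.
Proof.
move=> M1 HX HY; apply/subr0_eq/(lyapunov_homogeneous M1).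
by rewrite mulmxBr mulmxBl {1}HX {1}HY opprD addrACA subrr addr0.
Qed.

(** The map X - M X M^T is injective by [lyapunov_homogeneous], hence surjective in finite
    dimension; no series is summed. *)
Lemma lyapunov_exists M W : power_decay M ->
  exists X, X = M *m X *m M^T + W.
Proof.
move=> M1; pose f X := X - M *m X *m M^T.
have flin : linear f.
  move=> a X Y; rewrite /f mulmxDr mulmxDl -scalemxAr -scalemxAl scalerBr.
  by rewrite opprD addrACA.
pose fL := HB.pack f (GRing.isLinear.Build F 'M[F]_n 'M[F]_n *:%R f flin) : {linear 'M[F]_n -> 'M[F]_n}.
have fu : lin_mx fL \in unitmx.
  rewrite -row_free_unit -kermx_eq0; apply/negPn/negP => /rowV0Pn[v /sub_kermxP vf].
  case/negP; apply/eqP; rewrite -[v]vec_mxK.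
  suff -> : vec_mx v = 0 :> 'M[F]_n by rewrite linear0.
  apply: (lyapunov_homogeneous M1); apply/subr0_eq; apply: (can_inj mxvecK).
  rewrite -[_ - _]/(GRing.Linear.sort fL _) -mul_vec_lin vec_mxK vf.
  by rewrite linear0.
exists (vec_mx (mxvec W *m invmx (lin_mx fL))).
set X := vec_mx _; suff fX : f X = W by rewrite -fX /f addrC subrK.
apply: (can_inj mxvecK); rewrite -[f]/(GRing.Linear.sort fL) -mul_vec_lin.
by rewrite vec_mxK mulmxKV.
Qed.

(** The transpose solves the same equation, so uniqueness gives symmetry. For the sign, unrolling
    writes the form as a nonnegative part plus a geometrically small one. *)
Lemma lyapunov_psd M W X : power_decay M -> psdmx W ->
  X = M *m X *m M^T + W -> psdmx X.
Proof.
move=> M1 W0 HX; split.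
  apply: (lyapunov_unique M1 _ HX); rewrite {1}HX linearD /= !trmx_mul trmxK.
  by rewrite W0.1 mulmxA.
have [c [g [c0 g01 H]]] := M1 => x; rewrite -/(qform _ _) -oppr_le0.
apply: (le0_geometric (c := c * l1norm X * c * qform 1%:M x) g01) => k.
have [V Vk /(_ W0)/psdmx_qform V0] := lyapunov_iter k HX.
rewrite {1}Vk qformD opprD (@le_trans _ _ (- qform (M ^+ k *m X *m (M ^+ k)^T) x)) //.
  by rewrite gerDl oppr_le0.
rewrite -qformN (le_trans (qform_le_l1norm _ _)) // l1normN [leRHS]mulrAC.
rewrite ler_wpM2r ?l1norm_power_conj //; exact/psdmx_qform/psdmx1.
Qed.

(* Z is the adjoint Lyapunov solution: it represents W |-> tr X. *)
Lemma lyapunov_dual M : power_decay M -> exists2 Z, psdmx Z &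
  forall W X, X = M *m X *m M^T + W -> \tr X = \tr (Z *m W).
Proof.
move=> M1; have M1T := power_decay_tr M1.
have [Z HZ] := lyapunov_exists 1%:M M1T.
exists Z; first exact: lyapunov_psd M1T (psdmx1 _ _) HZ.
move=> W X HX.
(* Cyclicity of the trace moves the operator onto [Z], where its adjoint returns [1%:M]. *)
have -> : W = X - M *m X *m M^T by rewrite {1}HX addrC addKr.
rewrite mulmxBr raddfB /= -[X in _ - X]/(\tr (Z *m (M *m X *m M^T))).
rewrite mulmxA [\tr (_ *m M^T)]mxtrace_mulC !mulmxA.
rewrite trmxK in HZ; rewrite -raddfB /= -mulmxBl.
suff -> : Z - M^T *m Z *m M = 1%:M by rewrite mul1mx.
by rewrite {1}HZ addrC addKr.
Qed.

End Lyapunov.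

(** * Stability of the error dynamics *)

Section RealEigenvectors.
Variable F : realType.
Local Notation normc := ComplexField.Normc.normc.

Definition complex_row n (a b : 'rV[F]_n) : 'rV[F[i]]_n :=
  \row_j Complex (a 0 j) (b 0 j).

Lemma complex_row_mulmx n (a b : 'rV[F]_n) (M : 'M[F]_n) :
  complex_row a b *m map_mx (real_complex F) M = complex_row (a *m M) (b *m M).
Proof.
apply/rowP => j; rewrite !mxE.
transitivity (\sum_k Complex (a 0 k * M k j) (b 0 k * M k j)).
  apply: eq_bigr => k _; rewrite !mxE; apply/eqP; rewrite eq_complex /=.
  by rewrite !mulr0 subr0 add0r !eqxx.
elim/big_rec3: _ => [|k x y z _ ->]; first by [].
by apply/eqP; rewrite eq_complex /= !eqxx.
Qed.

(** The pair holds the real and imaginary parts of a row eigenvector, so that real quadratic forms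
    can be tested on it. *)
Lemma eigenvalue_real n (M : 'M[F]_n) (mu : F[i]) :
  eigenvalue (map_mx (real_complex F) M) mu <->
  exists ab : 'rV[F]_n * 'rV[F]_n,
    [/\ ab != 0, ab.1 *m M = complex.Re mu *: ab.1 - complex.Im mu *: ab.2
      & ab.2 *m M = complex.Re mu *: ab.2 + complex.Im mu *: ab.1].
Proof.
split=> [/eigenvalueP[v vM v0]|[[a b] /= [ab0 aM bM]]]; last first.
  apply/eigenvalueP; exists (complex_row a b).
    rewrite complex_row_mulmx aM bM; apply/rowP => j; rewrite !mxE.
    by case: mu {aM bM} => x y; apply/eqP; rewrite eq_complex /= !eqxx.
  apply: contraNneq ab0 => /rowP ab0; apply/eqP; congr pair; apply/rowP => j.
    by have := ab0 j; rewrite !mxE => -[].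
  by have := ab0 j; rewrite !mxE => -[].
pose a := map_mx (@complex.Re F) v; pose b := map_mx (@complex.Im F) v.
have vE : v = complex_row a b by apply/rowP => j; rewrite !mxE; case: (v 0 j).
rewrite vE complex_row_mulmx in vM v0; exists (a, b); split => /=.
- apply: contraNneq v0 => -[-> ->]; apply/eqP/rowP => j; rewrite !mxE.
  by apply/eqP; rewrite eq_complex /= !eqxx.
- apply/rowP => j; have /rowP/(_ j) := vM; rewrite !mxE.
  by case: (mu) => x y /= [-> _].
- apply/rowP => j; have /rowP/(_ j) := vM; rewrite !mxE.
  by case: (mu) => x y /= [_ ->].
Qed.

Lemma sqr_normc (mu : F[i]) :
  normc mu ^+ 2 = complex.Re mu ^+ 2 + complex.Im mu ^+ 2.
Proof. by case: mu => x y /=; rewrite sqr_sqrtr // addr_ge0 ?sqr_ge0. Qed.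

Lemma psdmx_kernel n p (R : 'M[F]_p) (K : 'M[F]_(n, p)) x :
  pdmx R -> qform (K *m R *m K^T) x <= 0 -> x^T *m K = 0.
Proof.
move=> [_ R0]; rewrite qform_conj => q0; apply/eqP; rewrite -trmx_eq0 trmx_mul trmxK.
by apply: contraTT q0 => /R0; rewrite -ltNge.
Qed.

(* A left eigenvector of err_mx A C K for an eigenvalue of modulus at least 1
   must be killed by K, and is then a left eigenvector of A. *)
Lemma err_mx_stable n m (A : 'M[F]_n) (C : 'M[F]_(m, n)) (R : 'M[F]_m)
    (K : 'M[F]_(n, m)) (X W : 'M[F]_n) :
    schur_stable A -> pdmx R -> psdmx X -> psdmx W ->
    X = err_mx A C K *m X *m (err_mx A C K)^T + W + K *m R *m K^T ->
  schur_stable (err_mx A C K).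
Proof.
move=> A1 Rpd X0 W0 HX mu muK; rewrite ltNge; apply/negP => mu1.
have /eigenvalue_real[[a b] /= [ab0 aM bM]] := muK.
set M := err_mx A C K in HX aM bM muK.
set x := complex.Re mu in aM bM; set y := complex.Im mu in aM bM.
have xy1 : 1 <= x ^+ 2 + y ^+ 2 by rewrite -sqr_normc expr_ge1 // (le_trans _ mu1).
pose bil (u v : 'rV[F]_n) := (u *m X *m v^T) 0 0.
have entryD (u v : 'M[F]_1) : (u + v) 0 0 = u 0 0 + v 0 0 by rewrite mxE.
have entryN (u : 'M[F]_1) : (- u) 0 0 = - u 0 0 by rewrite mxE.
have entryZ s (u : 'M[F]_1) : (s *: u) 0 0 = s * u 0 0 by rewrite mxE.
have qE u : qform (M *m X *m M^T) u^T = bil (u *m M) (u *m M).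
  by rewrite qform_conj -trmx_mul /bil /qform trmxK.
(* The sum over both parts is the Hermitian form at a + ib: cross terms cancel and the factor is
   |mu|^2. *)
have sumq : qform (M *m X *m M^T) a^T + qform (M *m X *m M^T) b^T =
    (x ^+ 2 + y ^+ 2) * (qform X a^T + qform X b^T).
  rewrite !qE aM bM /bil /qform !trmxK.
  have -> : (x *: a - y *: b)^T = x *: a^T - y *: b^T by rewrite linearB !linearZ.
  have -> : (x *: b + y *: a)^T = x *: b^T + y *: a^T by rewrite linearD !linearZ.
  rewrite !mulmxBl !mulmxDl !mulmxDr !mulmxN -!scalemxAl -!scalemxAr.
  by rewrite !(entryD, entryN, entryZ); ring.
have qa0 := psdmx_qform X0 a^T; have qb0 := psdmx_qform X0 b^T.
have Wa0 := psdmx_qform W0 a^T; have Wb0 := psdmx_qform W0 b^T.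
have KR0 := psdmx_conj K (pdmx_psd Rpd).
have Ka0 := psdmx_qform KR0 a^T; have Kb0 := psdmx_qform KR0 b^T.
have Ea : qform X a^T = qform (M *m X *m M^T) a^T + qform W a^T + qform (K *m R *m K^T) a^T.
  by rewrite {1}HX !qformD.
have Eb : qform X b^T = qform (M *m X *m M^T) b^T + qform W b^T + qform (K *m R *m K^T) b^T.
  by rewrite {1}HX !qformD.
have grow : qform X a^T + qform X b^T <= (x ^+ 2 + y ^+ 2) * (qform X a^T + qform X b^T).
  by rewrite ler_peMl // addr_ge0.
(* Since |mu| >= 1, the equation leaves no room for the nonnegative terms in [W] and
   [K *m R *m K^T]: they all vanish. *)
have /(psdmx_kernel Rpd) : qform (K *m R *m K^T) a^T <= 0 by lra.
rewrite trmxK => aK.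
have /(psdmx_kernel Rpd) : qform (K *m R *m K^T) b^T <= 0 by lra.
rewrite trmxK => bK.
suff /A1 : eigenvalue (map_mx (real_complex F) A) mu by rewrite ltNge mu1.
apply/eigenvalue_real; exists (a, b); split=> //=.
  by rewrite -aM /M /err_mx mulmxBr !mulmxA aK !mul0mx subr0.
by rewrite -bM /M /err_mx mulmxBr !mulmxA bK !mul0mx subr0.
Qed.

End RealEigenvectors.

(** * Algebraic Riccati equation *)

Section Riccati.
Variables (F : realType) (n m : nat) (A : 'M[F]_n) (C : 'M[F]_(m, n)).
Implicit Types (X Y Q : 'M[F]_n) (R : 'M[F]_m) (K L : 'M[F]_(n, m)).

Definition innov_cov R X : 'M[F]_m := C *m X *m C^T + R.

Definition gain R X : 'M[F]_(n, m) := X *m C^T *m invmx (innov_cov R X).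

(** Joseph form of the measurement update: meaningful for every gain [L], visibly semidefinite, and
    affine in [X]. *)
Definition post_cov R L X : 'M[F]_n :=
  innov_mx C L *m X *m (innov_mx C L)^T + L *m R *m L^T.

Definition riccati_map Q R X : 'M[F]_n :=
  A *m post_cov R (gain R X) X *m A^T + Q.

Lemma kalman_gainE Q R : kalman_gain A C Q R = gain R (riccati A C Q R).
Proof. by []. Qed.

Lemma innov_cov_pd R X : pdmx R -> psdmx X -> pdmx (innov_cov R X).
Proof. by move=> R0 X0; apply: pdmxD_psd R0; exact: psdmx_conj. Qed.

Lemma post_covE R L X : post_cov R L X =
  X - L *m C *m X - X *m C^T *m L^T + L *m innov_cov R X *m L^T.
Proof.
rewrite /post_cov /innov_mx /innov_cov linearB /= trmx1 trmx_mul.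
rewrite mulmxBl mul1mx mulmxBr mulmx1 mulmxBl !mulmxDr !mulmxDl !mulmxA.
by rewrite opprB addrA [X in X + _]addrAC !addrA.
Qed.

Lemma gain_mul R X : pdmx R -> psdmx X -> gain R X *m innov_cov R X = X *m C^T.
Proof. by move=> R0 X0; rewrite mulmxKV // pdmx_unit //; exact: innov_cov_pd. Qed.

Lemma gain_quad R X : pdmx R -> psdmx X ->
  gain R X *m innov_cov R X *m (gain R X)^T = gain R X *m C *m X.
Proof.
move=> R0 X0; rewrite -mulmxA -{1}(innov_cov_pd R0 X0).1 -trmx_mul gain_mul //.
by rewrite trmx_mul trmxK X0.1 mulmxA.
Qed.

Lemma post_cov_gain R X : pdmx R -> psdmx X ->
  post_cov R (gain R X) X = X - gain R X *m C *m X.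
Proof.
by move=> R0 X0; rewrite post_covE -(gain_mul R0 X0) subrK.
Qed.

(** [post_cov] is quadratic in [L] with leading coefficient [innov_cov], and [gain] is its
    stationary point by [gain_mul]. *)
Lemma complete_square R L X : pdmx R -> psdmx X ->
  post_cov R L X = post_cov R (gain R X) X
    + (L - gain R X) *m innov_cov R X *m (L - gain R X)^T.
Proof.
move=> R0 X0; rewrite post_cov_gain // post_covE linearB /= mulmxBr !mulmxBl.
rewrite gain_quad // gain_mul //.
have -> : L *m innov_cov R X *m (gain R X)^T = L *m C *m X.
  rewrite -mulmxA -{1}(innov_cov_pd R0 X0).1 -trmx_mul gain_mul //.
  by rewrite trmx_mul trmxK X0.1 mulmxA.
set a := L *m C *m X; set b := X *m C^T *m L^T; set c := gain R X *m C *m X.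
set d := L *m innov_cov R X *m L^T.
by clearbody a b c d; apply/matrixP => i j; rewrite !mxE; ring.
Qed.

Lemma post_cov_psd R L X : psdmx R -> psdmx X -> psdmx (post_cov R L X).
Proof. by move=> R0 X0; apply: psdmxD; exact: psdmx_conj. Qed.

Lemma post_cov_min R L X : pdmx R -> psdmx X ->
  psdmx (post_cov R L X - post_cov R (gain R X) X).
Proof.
move=> R0 X0; rewrite complete_square // addrC addKr.
exact/psdmx_conj/pdmx_psd/innov_cov_pd.
Qed.

Lemma post_cov_mono R L X Y :
  psdmx (Y - X) -> psdmx (post_cov R L Y - post_cov R L X).
Proof.
move=> /(psdmx_conj (innov_mx C L)).
by rewrite mulmxBr mulmxBl /post_cov opprD addrACA subrr addr0.
Qed.

Lemma psdmx_trans X Y Z : psdmx (Y - X) -> psdmx (Z - Y) -> psdmx (Z - X).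
Proof. by move=> h1 h2; rewrite -(subrK Y Z) -addrA; exact: psdmxD. Qed.

Lemma psdmx_anti X Y : psdmx (Y - X) -> psdmx (X - Y) -> X = Y.
Proof.
move=> YX XY; apply/subr0_eq/psdmx_trace0 => //.
by rewrite -opprB raddfN oppr_le0 psdmx_trace_ge0.
Qed.

Lemma riccati_map_le Q R L X : pdmx R -> psdmx X ->
  psdmx (A *m post_cov R L X *m A^T + Q - riccati_map Q R X).
Proof.
move=> R0 X0; rewrite /riccati_map opprD addrACA subrr addr0 -mulmxBl -mulmxBr.
exact/psdmx_conj/post_cov_min.
Qed.

Lemma riccati_map_psd Q R X :
  psdmx Q -> pdmx R -> psdmx X -> psdmx (riccati_map Q R X).
Proof.
move=> Q0 R0 X0; apply: psdmxD Q0; apply: psdmx_conj.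
exact: post_cov_psd (pdmx_psd R0) X0.
Qed.

(** The gain of [Y] is suboptimal for [X], and with that gain frozen the step is monotone. *)
Lemma riccati_map_mono Q R X Y : pdmx R -> psdmx X -> psdmx Y ->
  psdmx (Y - X) -> psdmx (riccati_map Q R Y - riccati_map Q R X).
Proof.
move=> R0 X0 Y0 XY; apply: psdmx_trans (riccati_map_le Q (gain R Y) R0 X0) _.
rewrite /riccati_map opprD addrACA subrr addr0 -mulmxBl -mulmxBr.
exact/psdmx_conj/post_cov_mono.
Qed.

Lemma riccati_solP Q R X : pdmx R ->
  riccati_sol A C Q R X <-> psdmx X /\ X = riccati_map Q R X.
Proof.
move=> R0; rewrite /riccati_sol; split=> -[X0 HX]; split=> //;
  move: HX; rewrite /riccati_map post_cov_gain // /gain /innov_cov mulmxBr mulmxBl;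
  by rewrite !mulmxA.
Qed.

(** The forms converge as bounded monotone sequences, and polarization passes this on to the
    entries. The last clause carries lower bounds to the limit, which spares later uses any
    topology. *)
Lemma psdmx_decreasing_limit (u : nat -> 'M[F]_n) :
    (forall k, psdmx (u k)) -> (forall k, psdmx (u k - u k.+1)) ->
  exists X, [/\ psdmx X, forall k, psdmx (u k - X)
    & forall x a, (forall k, a <= qform (u k) x) -> a <= qform X x].
Proof.
move=> u0 du.
have qdec x : nonincreasing_seq (fun k => qform (u k) x).
  apply/nonincreasing_seqP => k; have := psdmx_qform (du k) x.
  by rewrite qformB subr_ge0.
have qcvg x : cvgn (fun k => qform (u k) x).
  apply: nonincreasing_is_cvgn => //; exists 0 => _ [k _ <-].
  exact: psdmx_qform.
have ucvg i j : cvgn (fun k => u k i j).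
  pose x s : 'cV[F]_n := 1 *: delta_mx i 0 + s *: delta_mx j 0.
  have -> : (fun k => u k i j) =
      (fun k => 4^-1 *: (qform (u k) (x 1) - qform (u k) (x (-1)))).
    apply/funext => k; rewrite !qform_delta.
    have -> : u k j i = u k i j by rewrite -{1}(u0 k).1 mxE.
    by rewrite /GRing.scale /=; field.
  by apply: is_cvgZl_tmp; apply: is_cvgB.
pose X := \matrix_(i, j) limn (fun k => u k i j).
have uX x : (fun k => qform (u k) x) @ \oo --> qform X x.
  rewrite qformE.
  have -> : (fun k => qform (u k) x) = (fun k => \sum_j \sum_i x i 0 * u k i j * x j 0).
    by apply/funext => k; rewrite qformE.
  apply: cvg_big => [|j _]; first exact: add_continuous.
  apply: cvg_big => [|i _]; first exact: add_continuous.
  by apply: cvgMr_tmp; apply: cvgMl_tmp; rewrite mxE; exact: ucvg.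
have Xle k x : qform X x <= qform (u k) x.
  by rewrite -(cvg_lim _ (uX x)) //; exact: nonincreasing_cvgn_ge.
have Xs : X^T = X.
  apply/matrixP => i j; rewrite !mxE; congr (limn _); apply/funext => k.
  by rewrite -{1}(u0 k).1 mxE.
have Xge x a : (forall k, a <= qform (u k) x) -> a <= qform X x.
  move=> H; rewrite -(cvg_lim _ (uX x)) //; apply: limr_ge => //.
  exact: nearW.
exists X; split=> //.
  by split=> // x; apply: Xge => k; exact: psdmx_qform.
move=> k; split=> [|x]; first by rewrite linearB /= Xs (u0 k).1.
by rewrite -/(qform _ _) qformB subr_ge0.
Qed.

Hypothesis A1 : schur_stable A.

(* The limit X of the decreasing Riccati iteration is a fixed point without any
   continuity of the inverse: riccati_map is monotone, and riccati_map (u k) is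
   at most the step with the gain of X held fixed, which is affine in u k. *)
Lemma riccati_exists Q R : psdmx Q -> pdmx R -> exists X, riccati_sol A C Q R X.
Proof.
move=> Q0 R0; have A1' := schur_stable_power_decay A1.
(* [X0] is fixed by the step with gain 0, so the optimal step can only lower it and the iteration
   decreases. *)
have [X0 HX0] := lyapunov_exists Q A1'.
pose u k := iter k (riccati_map Q R) X0.
have u0 k : psdmx (u k).
  by elim: k => [|k IHk]; [exact: lyapunov_psd A1' Q0 HX0|exact: riccati_map_psd].
have du k : psdmx (u k - u k.+1).
  elim: k => [|k IHk]; last exact: riccati_map_mono R0 (u0 _) (u0 _) IHk.
  have := riccati_map_le Q 0 R0 (u0 0); rewrite /post_cov /innov_mx mul0mx subr0.
  by rewrite trmx1 mul1mx mulmx1 trmx0 mulmx0 addr0 -HX0.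
have [X [Xpsd Xle Xge]] := psdmx_decreasing_limit u0 du.
exists X; apply/riccati_solP => //; split=> //; apply: psdmx_anti; split=> [|x].
- by rewrite linearB /= (riccati_map_psd Q0 R0 Xpsd).1 Xpsd.1.
- rewrite -/(qform _ _) qformB subr_ge0.
  pose G := gain R X; pose y := (innov_mx C G)^T *m (A^T *m x).
  pose c := qform (G *m R *m G^T) (A^T *m x) + qform Q x.
  have stepE Y : qform (A *m post_cov R G Y *m A^T + Q) x = qform Y y + c.
    by rewrite /y qformD qform_conj /post_cov qformD qform_conj addrA.
  rewrite [leRHS]stepE -lerBlDr; apply: Xge => k; rewrite lerBlDr -stepE.
  apply: (@le_trans _ _ (qform (u k.+1) x)).
    by have := psdmx_qform (Xle k.+1) x; rewrite qformB subr_ge0.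
  by have := psdmx_qform (riccati_map_le Q G R0 (u0 k)) x; rewrite qformB subr_ge0.
- by rewrite linearB /= (riccati_map_psd Q0 R0 Xpsd).1 Xpsd.1.
- rewrite -/(qform _ _) qformB subr_ge0; apply: Xge => k.
  rewrite -subr_ge0 -qformB; apply: psdmx_qform.
  exact: psdmx_trans (riccati_map_mono Q R0 Xpsd (u0 k) (Xle k)) (du k).
Qed.

(** As [err_mx] is [innov_mx] times [A], the error recursion is a prediction followed by an update;
    this links it to the Riccati step. *)
Lemma err_stepE Q R K X : post_cov R K (A *m X *m A^T + Q) =
  err_mx A C K *m X *m (err_mx A C K)^T
  + innov_mx C K *m Q *m (innov_mx C K)^T + K *m R *m K^T.
Proof.
have -> : err_mx A C K = innov_mx C K *m A by rewrite mulmxBl mul1mx.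
by rewrite /post_cov mulmxDr mulmxDl trmx_mul !mulmxA.
Qed.

(** A Riccati solution is the covariance before the measurement; the filter error is taken after
    it. *)
Definition opt_cov R X := post_cov R (gain R X) X.

(** For an arbitrary gain [K], the optimal covariance satisfies the error equation of [K] up to the
    square of [K - gain R X]. *)
Lemma opt_cov_step Q R K X : pdmx R -> riccati_sol A C Q R X ->
  opt_cov R X + (K - gain R X) *m innov_cov R X *m (K - gain R X)^T =
  err_mx A C K *m opt_cov R X *m (err_mx A C K)^T
  + innov_mx C K *m Q *m (innov_mx C K)^T + K *m R *m K^T.
Proof.
move=> R0 /(riccati_solP _ _ R0)[X0 HX].
by rewrite -err_stepE -[_ + Q]/(riccati_map Q R X) -HX -complete_square.
Qed.

Lemma opt_cov_fixpoint Q R X : pdmx R -> riccati_sol A C Q R X ->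
  let K := gain R X in
  opt_cov R X = err_mx A C K *m opt_cov R X *m (err_mx A C K)^T
  + innov_mx C K *m Q *m (innov_mx C K)^T + K *m R *m K^T.
Proof.
by move=> R0 HX K; rewrite -opt_cov_step // subrr trmx0 mulmx0 addr0.
Qed.

Lemma gain_stable Q R X : psdmx Q -> pdmx R -> riccati_sol A C Q R X ->
  schur_stable (err_mx A C (gain R X)).
Proof.
move=> Q0 R0 HX; apply: (err_mx_stable A1 R0 _ _ (opt_cov_fixpoint R0 HX)).
  exact: post_cov_psd (pdmx_psd R0) HX.1.
exact: psdmx_conj.
Qed.

(** Under the stable dynamics of the gain of [U], the difference of the two updated covariances
    solves a Lyapunov equation with semidefinite source, so it is semidefinite. Exchanging the roles
    gives equality, and one prediction step recovers the Riccati solutions. *)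
Lemma riccati_unique Q R X Y : psdmx Q -> pdmx R ->
  riccati_sol A C Q R X -> riccati_sol A C Q R Y -> X = Y.
Proof.
move=> Q0 R0.
have half U V : riccati_sol A C Q R U -> riccati_sol A C Q R V ->
    psdmx (opt_cov R U - opt_cov R V).
  move=> HU HV; set K := gain R U; set M := err_mx A C K.
  set W := (K - gain R V) *m innov_cov R V *m (K - gain R V)^T.
  have M1 := schur_stable_power_decay (gain_stable Q0 R0 HU).
  apply: (lyapunov_psd (W := W) M1).
    exact/psdmx_conj/pdmx_psd/innov_cov_pd/HV.1.
  rewrite mulmxBr mulmxBl -/M.
  have := opt_cov_fixpoint R0 HU; have := opt_cov_step K R0 HV.
  rewrite /= -/K -/M -/W => EV EU.
  have {}EV : opt_cov R V = M *m opt_cov R V *m M^T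
      + (innov_mx C K *m Q *m (innov_mx C K)^T + K *m R *m K^T) - W.
    by rewrite addrA -EV addrK.
  rewrite -addrA in EU; rewrite {1}EU {1}EV.
  set S := innov_mx C K *m Q *m _ + _.
  by rewrite opprB [W - _]addrC opprD addrA addrACA subrr addr0.
move=> HX HY; have /(riccati_solP _ _ R0)[_ XE] := HX; have /(riccati_solP _ _ R0)[_ YE] := HY.
rewrite XE YE /riccati_map -!/(opt_cov R _).
by rewrite (psdmx_anti (half _ _ HY HX) (half _ _ HX HY)).
Qed.

End Riccati.

(** * Filter error, sensitivity and optimal gain *)

Section FilterError.
Variables (F : realType) (n m : nat) (A : 'M[F]_n) (C : 'M[F]_(m, n)).
Implicit Types (X Y Q : 'M[F]_n) (R : 'M[F]_m) (K L : 'M[F]_(n, m)).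

Lemma err_covE Q R K : schur_stable (err_mx A C K) ->
  err_cov A C Q R K = err_mx A C K *m err_cov A C Q R K *m (err_mx A C K)^T
    + (innov_mx C K *m Q *m (innov_mx C K)^T + K *m R *m K^T).
Proof.
move=> /schur_stable_power_decay/lyapunov_exists K1.
have [P HP] := K1 (innov_mx C K *m Q *m (innov_mx C K)^T + K *m R *m K^T).
have /getPex : exists P, [set P : 'M[F]_n | P = err_mx A C K *m P *m (err_mx A C K)^T
    + innov_mx C K *m Q *m (innov_mx C K)^T + K *m R *m K^T] P.
  by exists P; rewrite /= -addrA.
by rewrite addrA.
Qed.

(** One [Z], depending on [K] alone, serves all noises; linearity in the noises and the gradient in
    [R] follow. *)
Lemma filter_err_dual K : schur_stable (err_mx A C K) ->
  exists2 Z, psdmx Z & forall Q R, filter_err A C Q R K =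
    \tr (Z *m (innov_mx C K *m Q *m (innov_mx C K)^T + K *m R *m K^T)).
Proof.
move=> K1; have [Z Z0 HZ] := lyapunov_dual (schur_stable_power_decay K1).
by exists Z => // Q R; apply: HZ; exact: err_covE.
Qed.

Lemma filter_err_lin K a b Q Q' R R' : schur_stable (err_mx A C K) ->
  filter_err A C (a *: Q + b *: Q') (a *: R + b *: R') K =
  a * filter_err A C Q R K + b * filter_err A C Q' R' K.
Proof.
move=> /filter_err_dual[Z _ ZE]; rewrite !ZE -!mxtraceZ -mxtraceD.
congr (\tr _); rewrite !scalemxAr -mulmxDr !scalerDr addrACA.
congr (Z *m (_ + _)).
  by rewrite mulmxDr mulmxDl -!scalemxAr -!scalemxAl.
by rewrite mulmxDr mulmxDl -!scalemxAr -!scalemxAl.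
Qed.

Lemma err_cov_psd Q R K : schur_stable (err_mx A C K) ->
  psdmx Q -> psdmx R -> psdmx (err_cov A C Q R K).
Proof.
move=> K1 Q0 R0; apply: lyapunov_psd (schur_stable_power_decay K1) _ (err_covE _ _ K1).
by apply: psdmxD; exact: psdmx_conj.
Qed.

Lemma filter_err_ge0 Q R K : schur_stable (err_mx A C K) ->
  psdmx Q -> psdmx R -> 0 <= filter_err A C Q R K.
Proof. by move=> *; exact/psdmx_trace_ge0/err_cov_psd. Qed.

Lemma trace_mul_continuous p (L : 'M[F]_p) : continuous (fun H : 'M[F]_p => \tr (L *m H)).
Proof.
move=> H; have HF : Filter (nbhs H) := nbhs_filter H.
apply: (@cvg_big _ _ _ _ _ _ _ (nbhs H) _ (fun i (G : 'M[F]_p) => (L *m G) i i)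
  (fun i => (L *m H) i i) HF); first exact: add_continuous.
move=> i _; under eq_fun do rewrite mxE; rewrite mxE.
apply: (@cvg_big _ _ _ _ _ _ _ (nbhs H) _ (fun j (G : 'M[F]_p) => L i j * G j i)
  (fun j => L i j * H j i) HF); first exact: add_continuous.
by move=> j _; apply: cvgMl_tmp; exact: coord_continuous.
Qed.

(** In [R] the error is a constant plus H |-> tr(K^T Z K H), and the trace of the gradient is this
    linear part at the identity. *)
Lemma sensitivityE Q R K : schur_stable (err_mx A C K) ->
  sensitivity A C Q R K = filter_err A C 0 1%:M K.
Proof.
move=> K1; have [Z _ ZE] := filter_err_dual K1.
pose L := K^T *m Z *m K; pose f H := \tr (L *m H).
have flin : linear f.
  by move=> a X Y; rewrite /f mulmxDr -scalemxAr mxtraceD mxtraceZ.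
pose fL := HB.pack f (GRing.isLinear.Build F 'M[F]_m F *:%R f flin) : {linear 'M[F]_m -> F}.
have trE (H : 'M[F]_m) : \tr (Z *m (K *m H *m K^T)) = f H.
  by rewrite /f /L mulmxA mxtrace_mulC !mulmxA.
pose c := \tr (Z *m (innov_mx C K *m Q *m (innov_mx C K)^T)).
have gE : (fun R' => filter_err A C Q R' K) = cst c + f.
  by apply/funext => H; rewrite ZE mulmxDr mxtraceD trE.
have fcont : continuous fL by exact: trace_mul_continuous.
have fd : is_diff R (cst c + f) f.
  have h1 : is_diff R f f.
    by apply: DiffDef; [exact: (linear_differentiable R fcont)|exact: (diff_lin R fcont)].
  have h2 := is_diffD (is_diff_cst c R) h1.
  by rewrite [X in is_diff _ _ X]add0r in h2.
rewrite /sensitivity gE /mx_gradient; set G := get _.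
have /getPex[_ GE] : exists G, [set G : 'M[F]_m | differentiable (cst c + f) R /\
    forall H : 'M[F]_m, 'd (cst c + f) R H = \tr (G^T *m H)] G.
  exists L^T; split; first exact: ex_diff.
  by move=> H; rewrite trmxK diff_val.
(* The trace of [G] is the derivative in the direction [1%:M]. *)
have := GE 1%:M; rewrite mulmx1 mxtrace_tr => <-.
rewrite diff_val -trE ZE !mulmx0 mul0mx add0r //.
Qed.

Hypothesis A1 : schur_stable A.

Lemma riccatiP Q R : psdmx Q -> pdmx R -> riccati_sol A C Q R (riccati A C Q R).
Proof.
move=> Q0 R0; have [X HX] := riccati_exists C A1 Q0 R0.
by have /getPex : exists X, [set X | riccati_sol A C Q R X] X by exists X.
Qed.

Lemma kalman_stable Q R : psdmx Q -> pdmx R ->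
  schur_stable (err_mx A C (kalman_gain A C Q R)).
Proof. move=> Q0 R0; rewrite kalman_gainE.
exact: (gain_stable A1 Q0 R0 (riccatiP Q0 R0)). Qed.

Definition fro2 p q (H : 'M[F]_(p, q)) : F := \tr (H *m H^T).

Lemma entry_le_fro2 p q (H : 'M[F]_(p, q)) i j : H i j ^+ 2 <= fro2 H.
Proof.
have E k : (H *m H^T) k k = \sum_l H k l ^+ 2.
  by rewrite mxE; apply: eq_bigr => l _; rewrite mxE expr2.
rewrite /fro2 /mxtrace (bigD1 i) //= E (bigD1 j) //= -addrA lerDl addr_ge0 //.
  by apply: sumr_ge0 => l _; exact: sqr_ge0.
by apply: sumr_ge0 => k _; rewrite E; apply: sumr_ge0 => l _; exact: sqr_ge0.
Qed.

Lemma fro2_eq0 p q (H : 'M[F]_(p, q)) : fro2 H <= 0 -> H = 0.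
Proof.
move=> H0; apply/matrixP => i j; rewrite mxE; apply/eqP.
by rewrite -sqrf_eq0 eq_le sqr_ge0 (le_trans (entry_le_fro2 _ _ _)).
Qed.

Lemma fro2_ge0 p q (H : 'M[F]_(p, q)) : 0 <= fro2 H.
Proof. by rewrite /fro2 -[H in H *m _]mulmx1; exact/psdmx_trace_ge0/psdmx_conj/psdmx1. Qed.

Lemma l1norm_fro2 p q (H : 'M[F]_(p, q)) :
  l1norm H <= (p * q)%:R * Num.sqrt (fro2 H).
Proof.
have -> : (p * q)%:R * Num.sqrt (fro2 H) = \sum_(i < p) \sum_(j < q) Num.sqrt (fro2 H).
  by rewrite !sumr_const !card_ord mulrC mulr_natr mulnC mulrnA.
rewrite ler_sum // => i _; rewrite ler_sum // => j _.
by rewrite -sqrtr_sqr ler_wsqrtr // entry_le_fro2.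
Qed.

(** The excess covariance [D] solves a Lyapunov equation with source [W], so it dominates [W]; and
    [W] dominates r (K - G)(K - G)^T because the innovation covariance is at least [R]. *)
Lemma kalman_optimal Q R r K : psdmx Q -> pdmx R -> psdmx (R - r *: 1%:M) ->
    schur_stable (err_mx A C K) ->
  filter_err A C Q R (kalman_gain A C Q R) + r * fro2 (K - kalman_gain A C Q R)
    <= filter_err A C Q R K.
Proof.
move=> Q0 R0 Rr K1; have HX := riccatiP Q0 R0.
rewrite kalman_gainE; set X := riccati A C Q R in HX *; set G := gain C R X.
have G1 : schur_stable (err_mx A C G) by exact: kalman_stable.
have GE : err_cov A C Q R G = opt_cov C R X.
  apply: (lyapunov_unique (schur_stable_power_decay G1) (err_covE _ _ G1)).
  by rewrite addrA; exact: opt_cov_fixpoint.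
set W := (K - G) *m innov_cov C R X *m (K - G)^T.
have W0 : psdmx W by exact/psdmx_conj/pdmx_psd/innov_cov_pd/HX.1.
set M := err_mx A C K; set D := err_cov A C Q R K - opt_cov C R X.
have DE : D = M *m D *m M^T + W.
  have EV : opt_cov C R X = M *m opt_cov C R X *m M^T
      + (innov_mx C K *m Q *m (innov_mx C K)^T + K *m R *m K^T) - W.
    by rewrite addrA -opt_cov_step // addrK.
  rewrite /D {1}EV {1}(err_covE _ _ K1) -/M [M *m (_ - _)]mulmxBr [(_ - _) *m M^T]mulmxBl.
  set S := innov_mx C K *m Q *m _ + _.
  by rewrite opprB [W - _]addrC opprD addrA addrACA subrr addr0.
have D0 : psdmx D := lyapunov_psd (schur_stable_power_decay K1) W0 DE.
have DW : \tr W <= \tr D.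
  by apply: psdmx_le_trace; rewrite {1}DE addrK; exact: (psdmx_conj _ D0).
rewrite /filter_err GE -lerBrDl -raddfB; apply: le_trans DW; rewrite /fro2.
rewrite -mxtraceZ; apply: psdmx_le_trace.
have -> : W - r *: ((K - G) *m (K - G)^T) =
    (K - G) *m (C *m X *m C^T + (R - r *: 1%:M)) *m (K - G)^T.
  rewrite addrA /W; set H := K - G; rewrite [in RHS]mulmxBr [RHS]mulmxBl.
  congr (_ - _).
  by rewrite -scalemxAr mulmx1 scalemxAl.
by apply/psdmx_conj/psdmxD => //; apply: psdmx_conj HX.1.
Qed.

Lemma kalman_le Q R K : psdmx Q -> pdmx R -> schur_stable (err_mx A C K) ->
  filter_err A C Q R (kalman_gain A C Q R) <= filter_err A C Q R K.
Proof.
move=> Q0 R0 K1; have [r /andP[r0 _] Rr] := pdmx_lower_bound R0.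
apply: le_trans (kalman_optimal Q0 R0 Rr K1).
by rewrite lerDl mulr_ge0 ?fro2_ge0 // ltW.
Qed.

Lemma kalman_unique Q R K : psdmx Q -> pdmx R -> schur_stable (err_mx A C K) ->
  filter_err A C Q R K <= filter_err A C Q R (kalman_gain A C Q R) ->
  K = kalman_gain A C Q R.
Proof.
move=> Q0 R0 K1 Kle; have [r /andP[r0 _] Rr] := pdmx_lower_bound R0.
apply/subr0_eq/fro2_eq0; rewrite -(pmulr_rle0 _ r0).
by have := le_trans (kalman_optimal Q0 R0 Rr K1) Kle; rewrite gerDl.
Qed.

Lemma filter_errZ K a Q R : schur_stable (err_mx A C K) ->
  filter_err A C (a *: Q) (a *: R) K = a * filter_err A C Q R K.
Proof.
move=> K1; have := filter_err_lin a 0 Q 0 R 0 K1.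
by rewrite !scaler0 !addr0 mul0r addr0.
Qed.

(** Scaling both noises scales the cost, so the unique minimizer stays put. *)
Lemma kalman_gainZ a Q R : 0 < a -> psdmx Q -> pdmx R ->
  kalman_gain A C (a *: Q) (a *: R) = kalman_gain A C Q R.
Proof.
move=> a0 Q0 R0; have aQ0 := psdmxZ (ltW a0) Q0; have aR0 := pdmxZ a0 R0.
have K1 := kalman_stable aQ0 aR0; have G1 := kalman_stable Q0 R0.
have := kalman_le aQ0 aR0 G1.
rewrite (filter_errZ _ _ _ K1) (filter_errZ _ _ _ G1) (ler_pM2l a0).
exact: (kalman_unique Q0 R0 K1).
Qed.

End FilterError.

(** * Path of gains from zero to the Kalman gain *)

Section GainPath.
Variables (F : realType) (n m : nat) (A : 'M[F]_n) (C : 'M[F]_(m, n)).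
Variables (Q : 'M[F]_n) (R : 'M[F]_m).
Hypotheses (A1 : schur_stable A) (Q0 : psdmx Q) (R0 : pdmx R).

Local Notation P := (filter_err A C Q R).
Local Notation S := (filter_err A C 0 1%:M).

Definition path_noise (t : F) : 'M[F]_m := (1 - t) *: 1%:M + t *: R.

Definition path_gain (t : F) := kalman_gain A C (t *: Q) (path_noise t).

(** A segment from the identity to [R] stays above r I when both ends do; this is where [r <= 1]
    enters. *)
Lemma path_noise_bound : exists2 r, 0 < r <= 1 & psdmx (R - r *: 1%:M) /\
  forall t, 0 <= t <= 1 -> psdmx (path_noise t - r *: 1%:M).
Proof.
have [r /andP[r0 r1] Rr] := pdmx_lower_bound R0.
exists r; [by rewrite r0|split=> // t /andP[t0 t1]].
have -> : path_noise t - r *: 1%:M =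
    ((1 - t) * (1 - r)) *: 1%:M + t *: (R - r *: 1%:M).
  by apply/matrixP => i j; rewrite !mxE; ring.
apply: psdmxD; last exact: psdmxZ.
by apply: psdmxZ (psdmx1 _ _); rewrite mulr_ge0 // subr_ge0.
Qed.

Lemma path_noise_pd t : 0 <= t <= 1 -> pdmx (path_noise t).
Proof.
move=> t01; have [r /andP[r0 _] [_ Rr]] := path_noise_bound.
rewrite -(subrK (r *: 1%:M) (path_noise t)).
by apply: pdmxD_psd (Rr _ t01) _; apply: pdmxZ r0 (pdmx1 _ _).
Qed.

Lemma path_gain_stable t : 0 <= t <= 1 -> schur_stable (err_mx A C (path_gain t)).
Proof.
move=> t01; have tQ0 : psdmx (t *: Q) by apply: psdmxZ Q0; case/andP: t01.
exact: (kalman_stable A1 tQ0 (path_noise_pd t01)).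
Qed.

Lemma path_err t K : schur_stable (err_mx A C K) ->
  filter_err A C (t *: Q) (path_noise t) K = (1 - t) * S K + t * P K.
Proof. by move=> K1; rewrite -(filter_err_lin _ _ _ _ _ _ K1) scaler0 add0r. Qed.

Lemma path_gain_optimal r t K : psdmx (path_noise t - r *: 1%:M) ->
  0 <= t <= 1 -> schur_stable (err_mx A C K) ->
  (1 - t) * S (path_gain t) + t * P (path_gain t) + r * fro2 (K - path_gain t)
    <= (1 - t) * S K + t * P K.
Proof.
move=> Rr t01 K1; rewrite -(path_err _ K1) -(path_err _ (path_gain_stable t01)).
have tQ0 : psdmx (t *: Q) by apply: psdmxZ Q0; case/andP: t01.
exact: (kalman_optimal A1 tQ0 (path_noise_pd t01) Rr K1).
Qed.

Lemma zero_stable : schur_stable (err_mx A C 0).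
Proof. by rewrite /err_mx !mul0mx subr0. Qed.

Lemma sens_zero : S 0 = 0.
Proof.
have [Z _ ->] := filter_err_dual zero_stable.
by rewrite !mulmx0 !mul0mx addr0 mulmx0 mxtrace0.
Qed.

(** At [t = 0] the cost is S, which the gain 0 makes vanish; the quadratic gap leaves no other
    minimizer. *)
Lemma path_gain0 : path_gain 0 = 0.
Proof.
have [r /andP[r0 _] [_ Rr]] := path_noise_bound.
have t01 : 0 <= (0 : F) <= 1 by rewrite lexx ler01.
have := path_gain_optimal (Rr _ t01) t01 zero_stable.
rewrite sens_zero mulr0 !mul0r !addr0 subr0 mul1r => H.
have S0 := filter_err_ge0 (path_gain_stable t01) (psdmx0 _ _) (psdmx1 _ _).
apply/eqP; rewrite -oppr_eq0 -sub0r; apply/eqP/fro2_eq0.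
by rewrite -(pmulr_rle0 _ r0); apply: le_trans H; rewrite lerDr.
Qed.

Lemma path_gain1 : path_gain 1 = kalman_gain A C Q R.
Proof. by rewrite /path_gain /path_noise subrr scale0r !scale1r add0r. Qed.

(** Comparison with the gain 0, where S vanishes, gives t P(K_t) <= t P(0); [t = 0] is apart because
    of the division. *)
Lemma path_bounds t : 0 <= t <= 1 -> 0 <= P (path_gain t) <= P 0.
Proof.
move=> t01; have Kt := path_gain_stable t01.
rewrite (filter_err_ge0 Kt Q0 (pdmx_psd R0)) /=.
have [->|tn0] := eqVneq t 0; first by rewrite path_gain0.
have [r /andP[r0 _] [_ Rr]] := path_noise_bound.
have t0 : 0 < t by rewrite lt0r tn0; case/andP: t01.
have := path_gain_optimal (Rr _ t01) t01 zero_stable.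
rewrite sens_zero mulr0 !add0r => H.
have S0 := filter_err_ge0 Kt (psdmx0 _ _) (psdmx1 _ _).
rewrite -(ler_pM2l t0) (le_trans _ H) // -addrA addrCA lerDl addr_ge0 //.
  by rewrite mulr_ge0 // subr_ge0; case/andP: t01.
by rewrite mulr_ge0 ?fro2_ge0 // ltW.
Qed.

(** P - r S is the error for the semidefinite noise R - r I. *)
Lemma sens_le r K : schur_stable (err_mx A C K) -> psdmx (R - r *: 1%:M) ->
  r * S K <= P K.
Proof.
move=> K1 Rr; have := filter_err_ge0 K1 Q0 Rr.
have -> : filter_err A C Q (R - r *: 1%:M) K = 1 * P K + (- r) * S K.
  by rewrite -(filter_err_lin _ _ _ _ _ _ K1) scaler0 addr0 !scale1r scaleNr.
by rewrite mul1r mulNr subr_ge0.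
Qed.

(* Adding the optimality inequalities at t and s cancels the optimal values and
   leaves the increment of an affine function, whence Hoelder exponent 1/2. *)
Lemma path_gain_holder : exists2 c, 0 <= c & forall s t,
  0 <= s <= 1 -> 0 <= t <= 1 ->
  l1norm (path_gain s - path_gain t) <= c * Num.sqrt `|s - t|.
Proof.
(* [b] bounds both P and S along the path, hence also their difference. *)
have [r /andP[r0 r1] [Rr Rt]] := path_noise_bound.
pose b := P 0 / r; pose c := 2 * b / r.
have P00 : 0 <= P 0 by exact: (filter_err_ge0 zero_stable Q0 (pdmx_psd R0)).
have b0 : 0 <= b by rewrite /b divr_ge0 ?(ltW r0).
have c0 : 0 <= c by rewrite /c divr_ge0 ?(ltW r0) // mulr_ge0 ?ler0n.
have Pb : P 0 <= b by rewrite /b ler_pdivlMr // ler_piMr.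
have incr t : 0 <= t <= 1 -> `|P (path_gain t) - S (path_gain t)| <= b.
  move=> t01; have Kt := path_gain_stable t01; have /andP[p0 p1] := path_bounds t01.
  have S0 := filter_err_ge0 Kt (psdmx0 _ _) (psdmx1 _ _).
  have Sb : S (path_gain t) <= b.
    by rewrite /b ler_pdivlMr // mulrC (le_trans (sens_le Kt Rr)).
  rewrite ler_norml; lra.
exists ((n * m)%:R * Num.sqrt c); first by rewrite mulr_ge0 ?sqrtr_ge0 ?ler0n.
move=> s t s01 t01; apply: le_trans (l1norm_fro2 _) _.
rewrite -mulrA ler_wpM2l // -sqrtrM // ler_wsqrtr //.
have Ht := path_gain_optimal (Rt _ t01) t01 (path_gain_stable s01).
(* Margin 0 drops the gap term here; the one in [Ht] is enough. *)
have s00 : psdmx (path_noise s - 0 *: 1%:M).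
  by rewrite scale0r subr0; exact/pdmx_psd/path_noise_pd.
have Hs := path_gain_optimal s00 s01 (path_gain_stable t01).
rewrite mul0r addr0 in Hs.
have it := incr _ t01; have is_ := incr _ s01.
move: Ht Hs it is_; set f := fro2 _.
move: (P (path_gain s)) (S (path_gain s)) (P (path_gain t)) (S (path_gain t)) => ps ss pt st.
move=> Ht Hs it is_.
(* The sum of [Ht] and [Hs] reads r f <= (s - t)(pt - st) + (t - s)(ps - ss). *)
have rf : r * f <= `|s - t| * b + `|s - t| * b.
  have h1 : (s - t) * (pt - st) <= `|s - t| * b.
    by apply: le_trans (ler_norm _) _; rewrite normrM ler_wpM2l.
  have h2 : (t - s) * (ps - ss) <= `|s - t| * b.
    by apply: le_trans (ler_norm _) _; rewrite normrM [`|t - s|]distrC ler_wpM2l.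
  lra.
have -> : c * `|s - t| = r^-1 * (`|s - t| * b + `|s - t| * b).
  by rewrite /c; field; rewrite gt_eqF.
by rewrite ler_pdivlMl.
Qed.

End GainPath.

(** * Continuity of the error and selection of lambda *)

Section ErrorAlongPath.
Variables (F : realType) (n m : nat) (A : 'M[F]_n) (C : 'M[F]_(m, n)).
Variables (Q : 'M[F]_n) (R : 'M[F]_m).
Hypotheses (A1 : schur_stable A) (Q0 : psdmx Q) (R0 : pdmx R).

Local Notation P := (filter_err A C Q R).
Local Notation path_gain := (path_gain A C Q R).

(** Each term carries a factor [L - K], ready for a norm estimate linear in it. *)
Lemma post_cov_diff K L X : post_cov C R L X - post_cov C R K X =
  - ((L - K) *m C *m X) - X *m C^T *m (L - K)^T
  + (L - K) *m innov_cov C R X *m L^T + K *m innov_cov C R X *m (L - K)^T.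
Proof.
rewrite !post_covE.
have -> : (L - K)^T = L^T - K^T by rewrite linearB.
rewrite !mulmxBl !mulmxBr.
set a := L *m C *m X; set b := K *m C *m X; set c := X *m C^T *m L^T.
set d := X *m C^T *m K^T; set W := innov_cov _ _ _.
set e := L *m W *m L^T; set f := K *m W *m L^T; set g := K *m W *m K^T.
by clearbody a b c d e f g; apply/matrixP => i j; rewrite !mxE; ring.
Qed.

Lemma l1normM2 p q r s (U : 'M[F]_(p, q)) (V : 'M[F]_(q, r)) (W : 'M[F]_(r, s)) u v w :
  l1norm U <= u -> l1norm V <= v -> l1norm W <= w ->
  l1norm (U *m V *m W) <= u * v * w.
Proof.
move=> Uu Vv Ww; have nn := @l1norm_ge0 F.
apply: le_trans (l1normM _ _) _; apply: ler_pM => //.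
by apply: le_trans (l1normM _ _) _; exact: ler_pM.
Qed.

(** Only the dynamics of [K] propagate the difference; [L] enters through the source, at its own
    predicted covariance [Y]. *)
Lemma err_cov_diff K L : schur_stable (err_mx A C K) -> schur_stable (err_mx A C L) ->
  let X := err_cov A C Q R L in let D := X - err_cov A C Q R K in
  let Y := A *m X *m A^T + Q in
  D = err_mx A C K *m D *m (err_mx A C K)^T + (post_cov C R L Y - post_cov C R K Y).
Proof.
move=> K1 L1; have := err_covE Q R L1; have := err_covE Q R K1.
move: (err_cov A C Q R L) (err_cov A C Q R K) => X V /=.
rewrite addrA -err_stepE => KE; rewrite addrA -err_stepE => LE.
rewrite -LE {1}KE !err_stepE; move: (err_mx A C K) => M.
rewrite [M *m (X - V)]mulmxBr [(_ - _) *m M^T]mulmxBl.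
set a := M *m X *m _; set e := innov_mx C K *m _ *m _.
set g := M *m V *m _; set h := K *m R *m _.
by clearbody a e g h; apply/matrixP => i j; rewrite !mxE; ring.
Qed.

(** Continuity at each [t] is the goal, so the constant may contain the adjoint [Z] at [t]. What
    depends on [s] is bounded uniformly by [path_bounds] and [path_gain_holder]. *)
Lemma filter_err_path_holder t : 0 <= t <= 1 -> exists2 c, 0 <= c & forall s,
  0 <= s <= 1 ->
  `|P (path_gain s) - P (path_gain t)| <= c * Num.sqrt `|s - t|.
Proof.
move=> t01; have [c c0 Hc] := path_gain_holder C A1 Q0 R0.
have Kt := path_gain_stable (C := C) A1 Q0 R0 t01.
have [Z Z0 ZE] := lyapunov_dual (schur_stable_power_decay Kt).
have P00 : 0 <= P 0 by exact: (filter_err_ge0 (zero_stable (C := C) A1) Q0 (pdmx_psd R0)).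
(* [p], [x], [w], [k] bound the error covariance at [s], its prediction, the innovation covariance
   and the gain; [d] is the resulting coefficient of the norm of [L - K]. *)
pose p := P 0 *+ n *+ n.
pose x := l1norm A * p * l1norm A + l1norm Q.
pose w := l1norm C * x * l1norm C + l1norm R.
pose k := l1norm (path_gain t) + c.
pose d := l1norm C * x + x * l1norm C + w * k + l1norm (path_gain t) * w.
have p0 : 0 <= p by rewrite !mulrn_wge0.
have nn := @l1norm_ge0 F.
have x0 : 0 <= x by rewrite !(addr_ge0, mulr_ge0).
have w0 : 0 <= w by rewrite !(addr_ge0, mulr_ge0).
have k0 : 0 <= k by rewrite addr_ge0.
have d0 : 0 <= d by rewrite !(addr_ge0, mulr_ge0).
exists (l1norm Z * d * c); first by rewrite !(addr_ge0, mulr_ge0).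
move=> s s01; have Ks := path_gain_stable (C := C) A1 Q0 R0 s01.
have Hh := Hc s t s01 t01.
have Xp : l1norm (err_cov A C Q R (path_gain s)) <= p.
  apply: le_trans (psdmx_l1norm (err_cov_psd Ks Q0 (pdmx_psd R0))) _.
  have /andP[_ sb] := path_bounds C A1 Q0 R0 s01.
  by rewrite /p !lerMn2r sb !orbT.
have DE := err_cov_diff Kt Ks.
rewrite /filter_err; have := ZE _ _ DE; rewrite raddfB /= => ->.
move: Hh Xp; clear DE ZE Kt Ks.
move: (path_gain s) @k @d k0 d0 => L.
move: (path_gain t) => K; move=> k d k0 d0; move: (err_cov A C Q R L) => X Hh Xp.
set Y := A *m X *m A^T + Q.
have st : Num.sqrt `|s - t| <= 1.
  rewrite -[leRHS]sqrtr1 ler_wsqrtr // ler_norml.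
  by move: s01 t01 => /andP[? ?] /andP[? ?]; lra.
have Yx : l1norm Y <= x.
  apply: le_trans (l1normD _ _) _; rewrite lerD2r.
  by apply: l1normM2; rewrite ?l1norm_tr.
have Ww : l1norm (innov_cov C R Y) <= w.
  apply: le_trans (l1normD _ _) _; rewrite lerD2r.
  by apply: l1normM2; rewrite ?l1norm_tr.
have Lk : l1norm L <= k.
  rewrite -(subrK K L) addrC; apply: le_trans (l1normD _ _) _.
  by rewrite lerD2l (le_trans Hh) // ler_piMr.
apply: le_trans (normr_trace_le _) _; apply: le_trans (l1normM _ _) _.
rewrite -!mulrA ler_wpM2l // post_cov_diff.
apply: (@le_trans _ _ (d * l1norm (L - K))); last by rewrite ler_wpM2l.
set h := l1norm (L - K).
have -> : d * h = h * l1norm C * x + x * l1norm C * h + h * w * k + l1norm K * w * h.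
  by rewrite /d; ring.
do 2![apply: le_trans (l1normD _ _) _; apply: lerD;
  last by apply: l1normM2; rewrite ?l1norm_tr].
by apply: le_trans (l1normD _ _) _; rewrite !l1normN; apply: lerD;
  apply: l1normM2; rewrite ?l1norm_tr.
Qed.

Lemma sqrt_modulus (c e : F) : 0 <= c -> 0 < e ->
  exists2 d, 0 < d & forall x, 0 <= x -> x < d -> c * Num.sqrt x <= e.
Proof.
move=> c0 e0; have c1 : 0 < c + 1 by rewrite ltr_wpDl.
exists ((e / (c + 1)) ^+ 2); first by rewrite exprn_gt0 // divr_gt0.
move=> x x0 /ltW xd; have q0 : 0 <= e / (c + 1) by rewrite ltW // divr_gt0.
apply: (@le_trans _ _ (c * (e / (c + 1)))).
  rewrite ler_wpM2l // -[leRHS]ger0_norm // -sqrtr_sqr.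
  by rewrite ler_wsqrtr.
by rewrite mulrCA ler_piMr ?(ltW e0) // ler_pdivrMr // mul1r lerDl.
Qed.

Lemma filter_err_path_surjective v : P (kalman_gain A C Q R) <= v <= P 0 ->
  exists2 t, 0 <= t <= 1 & P (path_gain t) = v.
Proof.
move=> /andP[v1 v0]; pose f t := P (path_gain t).
have f0 : f 0 = P 0 by rewrite /f (path_gain0 C A1 Q0 R0).
have f1 : f 1 = P (kalman_gain A C Q R) by rewrite /f path_gain1.
have fc : {within `[(0 : F), 1], continuous f}.
  apply/subspace_continuousP => t; rewrite /= in_itv /= => t01.
  have [c c0 Hc] := filter_err_path_holder t01.
  apply/cvgrPdist_le => e e0; have [d d0 Hd] := sqrt_modulus c0 e0.
  near=> s; rewrite distrC.
  have s01 : 0 <= s <= 1.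
    have : `[0, 1]%classic s by near: s; exact: withinT.
    by rewrite /= in_itv.
  apply: le_trans (Hc _ s01) _; apply: Hd => //.
  near: s; apply: cvg_within; exists d => //= s; rewrite distrC; exact.
have [|t] := IVT (v := v) ler01 fc.
  by rewrite f0 f1 ge_min le_max v1 v0 orbT.
by rewrite in_itv /= => t01 <-; exists t.
Unshelve. all: by end_near. Qed.

(** Multiplying both path noises by 1 + r gives r Q and I + r R, and the gain ignores a common
    factor. *)
Lemma Kstar_path r : 0 <= r -> Kstar A C Q R r%:E = path_gain (r / (1 + r)).
Proof.
move=> r0; have r1 : 0 < 1 + r by rewrite ltr_wpDr.
have t01 : 0 <= r / (1 + r) <= 1.
  by rewrite divr_ge0 ?(ltW r1) //= ler_pdivrMr // mul1r lerDr.
have tQ0 : psdmx ((r / (1 + r)) *: Q) by apply: psdmxZ Q0; case/andP: t01.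
rewrite /path_gain -(kalman_gainZ C A1 r1 tQ0 (path_noise_pd R0 t01)) /Kstar.
have r1n : 1 + r != 0 by rewrite gt_eqF.
have -> : (1 + r) *: (r / (1 + r) *: Q) = r *: Q by rewrite scalerA mulrC divfK.
suff -> : (1 + r) *: path_noise R (r / (1 + r)) = 1%:M + r *: R by [].
rewrite /path_noise scalerDr !scalerA [_ * (r / _)]mulrC divfK //.
by rewrite mulrBr mulr1 [_ * (r / _)]mulrC divfK // addrK scale1r.
Qed.

Lemma mx_norm_le_l1norm p q (M : 'M[F]_(p, q)) : `|M| <= l1norm M.
Proof.
have [->|] := eqVneq `|M| 0; first exact: l1norm_ge0.
move=> /mx_norm_neq0[i Mi]; have -> : `|M| = `|M i.1 i.2| by exact: Mi.
exact: entry_le_l1norm.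
Qed.

Lemma Kstar_cvg : Kstar A C Q R r%:E @[r --> +oo] --> kalman_gain A C Q R.
Proof.
have [c c0 Hc] := path_gain_holder C A1 Q0 R0.
apply/cvgrPdist_le => e e0; have [d d0 Hd] := sqrt_modulus c0 e0.
near=> r; have r0 : 0 < r by near: r; exact: nbhs_pinfty_gt.
have rd : d^-1 < r by near: r; apply: nbhs_pinfty_gt; exact: num_real.
have r1 : 0 < 1 + r by rewrite addr_gt0.
rewrite (Kstar_path (ltW r0)) -(path_gain1 A C Q R).
apply: le_trans (mx_norm_le_l1norm _) _.
apply: le_trans (Hc _ _ _ _) _; first by rewrite ler01 lexx.
  by rewrite divr_ge0 ?(ltW r1) ?(ltW r0) //= ler_pdivrMr // mul1r lerDr.
(* The distance to the end [t = 1] is 1/(1 + r), below [d] once r > 1/d. *)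
apply: Hd => //; have -> : 1 - r / (1 + r) = (1 + r)^-1.
  by field; rewrite gt_eqF.
rewrite gtr0_norm ?invr_gt0 // invf_plt ?posrE //.
by rewrite (lt_trans rd) // ltrDr.
Unshelve. all: by end_near. Qed.

End ErrorAlongPath.

(** The first two conjuncts certify that [riccati] and the limit in [Kstar] denote what they should;
    the last covers every selected [l], not just the one found by continuity. *)
Theorem mainTheorem1 (F : realType) (n m : nat)
    (A : 'M[F]_n) (C : 'M[F]_(m, n)) (Q : 'M[F]_n) (R : 'M[F]_m)
    (hA : spectral_radius A < 1) (hQ : psdmx Q) (hR : pdmx R)
    (delta : F)
    (hdelta : filter_err A C Q R (kalman_gain A C Q R) <= delta
              <= filter_err A C Q R 0) :
  let P := filter_err A C Q R in
  let Kkf := kalman_gain A C Q R in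
  let Ks := Kstar A C Q R in
  let selected (l : \bar F) :=
    [/\ (0 <= l)%E, l = +oo%E -> delta = P Kkf & P (Ks l) = delta] in
  [/\ forall r : F, 0 <= r ->
        exists! X : 'M[F]_n, riccati_sol A C (r *: Q) (1%:M + r *: R) X,
      Ks r%:E @[r --> +oo] --> Kkf,
      exists l : \bar F, selected l
    & forall l : \bar F, selected l ->
        global_min_at (sensitivity A C Q R) (feasible A C Q R delta) (Ks l)].
Proof.
move=> P Kkf Ks selected.
have A1 : schur_stable A by apply/spectral_radius_lt1.
have rQ r : 0 <= r -> psdmx (r *: Q) by move=> r0; exact: psdmxZ.
have rR r : 0 <= r -> pdmx (1%:M + r *: R).
  by move=> r0; rewrite addrC; apply: pdmxD_psd (pdmx1 _ _); exact/psdmxZ/pdmx_psd.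
have Kscvg : Ks r%:E @[r --> +oo] --> Kkf by exact: Kstar_cvg.
have Ksoo : Ks +oo%E = Kkf by apply: cvg_lim Kscvg; exact: norm_hausdorff.
split; [|exact: Kscvg| |].
- move=> r r0; have [X HX] := riccati_exists C A1 (rQ _ r0) (rR _ r0).
  by exists X; split=> // Y HY; exact: (riccati_unique A1 (rQ _ r0) (rR _ r0) HX HY).
- have [t /andP[t0 t1] tv] := filter_err_path_surjective A1 hQ hR hdelta.
  (* t = r/(1 + r) inverts to r = t/(1 - t), and [t = 1] corresponds to [+oo]. *)
  move: t1; rewrite le_eqVlt => /predU1P[te|t1].
    have PK : P Kkf = delta by rewrite -tv te path_gain1.
    by exists +oo%E; split; [exact: leey|move=> _; rewrite PK|rewrite Ksoo PK].
  have t1' : 0 < 1 - t by rewrite subr_gt0.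
  have r0 : 0 <= t / (1 - t) by rewrite divr_ge0 // ltW.
  exists (t / (1 - t))%:E; split; [by rewrite lee_fin|by []|].
  rewrite /P /Ks (Kstar_path C A1 hQ hR r0).
  have t1n : 1 - t != 0 by rewrite gt_eqF.
  have -> : 1 + t / (1 - t) = (1 - t)^-1 by field.
  by rewrite invrK divfK.
- move=> l [l0 loo PKs].
  suff [K1 Kopt] : schur_stable (err_mx A C (Ks l)) /\
      forall K, schur_stable (err_mx A C K) -> P K <= delta ->
        filter_err A C 0 1%:M (Ks l) <= filter_err A C 0 1%:M K.
    split; first by split; [apply/spectral_radius_lt1|rewrite -/P PKs].
    move=> K [/spectral_radius_lt1 hK PK].
    by rewrite (sensitivityE _ _ K1) (sensitivityE _ _ hK); exact: Kopt.
  case: l l0 loo PKs => [r|+ loo PKs|//]; last first.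
    (* Here [delta] is the minimal error, so every feasible gain is the Kalman gain by
       uniqueness. *)
    move=> _; rewrite Ksoo; split; first exact: (kalman_stable A1 hQ hR).
    move=> K K1; rewrite (loo erefl) => PK.
    by rewrite (kalman_unique A1 hQ hR K1 PK).
  rewrite lee_fin => r0 _ PKs.
  have K1 := kalman_stable (C := C) A1 (rQ _ r0) (rR _ r0).
  split; first exact: K1.
  move=> K hK PK; have := kalman_le A1 (rQ _ r0) (rR _ r0) hK.
  have split_err L : schur_stable (err_mx A C L) ->
      filter_err A C (r *: Q) (1%:M + r *: R) L = filter_err A C 0 1%:M L + r * P L.
    move=> L1; have := filter_err_lin 1 r 0 Q 1%:M R L1.
    by rewrite scaler0 add0r scale1r mul1r.
  rewrite (split_err _ K1) (split_err _ hK) -[kalman_gain _ _ _ _]/(Ks r%:E) PKs.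
  move=> H; rewrite -(lerD2r (r * delta)); apply: le_trans H _.
  by rewrite lerD2l ler_wpM2l.
Qed.
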